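(* Consider the regime in which $m$ is sufficiently large and $\sigma_h^2=\frac1m$, so that $C\approx1$. Let $\sigma_j^2=\sigma^2$ for all $j\in[n]$, and assume that $\phi\ge\lambda_{\max}(\mathbf{P})/\Delta$ for some $\Delta>1$. Put $$\mathrm{SNR}=\frac{\lambda_{\max}(\mathbf{P})}{\sigma^2},\qquad \kappa=\frac{\lambda_{\max}(\mathbf{P})}{\lambda_{\min}(\mathbf{P})}\ge1 .$$ Let $$\Delta\ge\kappa+c_1\frac nm\,\mathrm{SNR}$$ for some $c_1>1$. Then with probability $$p\ge1-m\exp\left(-\frac nm c_2\right)$$ it holds that $\mathcal{C}_{\max}\le\Delta^3$, for some $c_2>0$, where $\mathcal{C}_{\max}$ is the maximum element-wise curvature of $f(S)=\mathrm{Tr}(\mathbf{P}-\mathbf{F}_S^{-1})$.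
   Context: Let $[n]=\{1,\dots,n\}$. At a fixed time step, $\mathbf{P}\in\mathbb{R}^{m\times m}$ is a symmetric positive definite matrix (the Kalman filter's predicted error covariance $\mathbf{P}_{k|k-1}$), $\mathbf{h}_1,\dots,\mathbf{h}_n\in\mathbb{R}^m$ are the measurement (column) vectors of $n$ sensors, and $\sigma_1^2,\dots,\sigma_n^2>0$ are the sensors' noise variances. The vectors $\mathbf{h}_j$ are i.i.d. zero-mean random vectors with covariance matrix $\sigma_h^2\mathbf{I}_m$, and $\|\mathbf{h}_j\|_2^2\le C$ for all $j$, with $\sigma_h^2<C$. (Typical examples: $\mathbf{h}_j\sim\mathcal{N}(0,\frac1m\mathbf{I}_m)$, for which $\|\mathbf{h}_j\|_2^2$ concentrates around $1$; or entries $\pm\frac1{\sqrt m}$ with equal probability, for which $\|\mathbf{h}_j\|_2^2=1$.) For $S\subseteq[n]$, $$\mathbf{F}_S=\mathbf{P}^{-1}+\sum_{i\in S}\sigma_i^{-2}\mathbf{h}_i\mathbf{h}_i^\top .$$ $\lambda_{\max},\lambda_{\min}$ denote the largest and smallest eigenvalues. The quantity $\phi$ is $$\phi=\min_{j\in[n]}\left(\frac1{\lambda_{\min}(\mathbf{P})}+\frac{n\sigma_h^2+q}{\sigma_j^2}\right)^{-1},\qquad q>0 .$$ It plays the role of a number $0<\phi<\lambda_{\min}(\mathbf{P})$ with $$\lambda_{\max}\Big(\sum_{j=1}^n\mathbf{h}_j\mathbf{h}_j^\top\Big)\le\left(\frac1\phi-\frac1{\lambda_{\min}(\mathbf{P})}\right)\min_{j\in[n]}\sigma_j^2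 ,$$ and for the displayed choice this inequality holds with probability at least $1-m\exp\left(\frac{-q^2/2}{(C-\sigma_h^2)(n\sigma_h^2+q/3)}\right)$. Element-wise curvature: for a monotone non-decreasing $f:2^{[n]}\to\mathbb{R}$ put $f_i(S)=f(S\cup\{i\})-f(S)$ and $$\mathcal{C}_l=\max_{(S,T,i)\in\mathcal{X}_l}\frac{f_i(T)}{f_i(S)},\qquad \mathcal{X}_l=\{(S,T,i): S\subset T\subset[n],\ i\in[n]\setminus T,\ |T\setminus S|=l\};$$ the maximum element-wise curvature is $\mathcal{C}_{\max}=\max_l\mathcal{C}_l$. *)

(* Defs.v *)
From HB Require Import structures.
From mathcomp Require Import all_boot all_order all_algebra.
From mathcomp Require Import all_classical all_reals all_analysis.

Set Implicit Arguments.
Unset Strict Implicit.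
Unset Printing Implicit Defensive.

Import Order.TTheory GRing.Theory Num.Theory.
Import numFieldNormedType.Exports.

Local Open Scope classical_set_scope.
Local Open Scope ring_scope.

Section Matrices.
Context {R : realType}.

Definition posdefmx m (P : 'M[R]_m) : Prop :=
  P^T = P /\ forall x : 'cV[R]_m, x != 0 -> 0 < (x^T *m P *m x) 0 0.

(* Meant for symmetric matrices of positive size, whose set of eigenvalues is
   finite and nonempty, so that the bounds are attained. *)
Definition lambda_max m (A : 'M[R]_m) : R := sup [set a | eigenvalue A a].
Definition lambda_min m (A : 'M[R]_m) : R := inf [set a | eigenvalue A a].

(* The library norm on matrices is the max norm, hence this definition. *)
Definition sqnorm2 m (x : 'cV[R]_m) : R := \sum_(i < m) x i 0 ^+ 2.

End Matrices.

Section Sensors.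
Context {R : realType} {m n : nat}.
Implicit Types (P : 'M[R]_m) (h : 'I_n -> 'cV[R]_m).

(* [sigma2 j] is the noise variance of sensor [j]. *)
Definition Fmx P h (sigma2 : 'I_n -> R) (S : {set 'I_n}) : 'M[R]_m :=
  invmx P + \sum_(i in S) (sigma2 i)^-1 *: (h i *m (h i)^T).

Definition mse_gain P h (sigma2 : 'I_n -> R) (S : {set 'I_n}) : R :=
  \tr (P - invmx (Fmx P h sigma2 S)).

(* The infimum of a finite set, which is a minimum as soon as 0 < n. *)
Definition phi P (sigma2 : 'I_n -> R) (sigmah2 q : R) : R :=
  inf (range (fun j : 'I_n =>
    ((lambda_min P)^-1 + (n%:R * sigmah2 + q) / sigma2 j)^-1)).

Definition SNR P (s2 : R) : R := lambda_max P / s2.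

Definition kappa P : R := lambda_max P / lambda_min P.

End Sensors.

Section Curvature.
Context {R : realType} {n : nat}.
Implicit Types f : {set 'I_n} -> R.

Definition marginal f (i : 'I_n) (S : {set 'I_n}) : R := f (i |: S) - f S.

Definition curv_triples (l : nat) : {set {set 'I_n} * {set 'I_n} * 'I_n} :=
  [set x : {set 'I_n} * {set 'I_n} * 'I_n |
           let: (A, B, i) := x in
           [&& A \proper B, B \proper [set: 'I_n], i \notin B
             & #|B :\: A| == l]]%SET.

(* The quotients are taken in the extended reals, where a / 0 = +oo for a > 0
   and 0 / 0 = 0; the maximum of an empty family is -oo. *)
Definition elem_curvature f (l : nat) : \bar R :=
  \big[maxe/-oo%E]_(x in curv_triples l)
    (let: (A, B, i) := x in (marginal f i B)%:E / (marginal f i A)%:E)%E.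

(* [curv_triples l] is empty unless 0 < l < n. *)
Definition max_curvature f : \bar R :=
  \big[maxe/-oo%E]_(1 <= l < n) elem_curvature f l.

End Curvature.

Section RandomVectors.
Context {d : measure_display} {T : measurableType d} {R : realType}.
Variable Pr : probability T R.

Definition borel_vec m (B : set 'cV[R]_m) : Prop :=
  <<s [set A : set 'cV[R]_m | open A] >> B.

Definition random_vec m (X : T -> 'cV[R]_m) : Prop :=
  forall B, borel_vec B -> measurable (X @^-1` B).

Definition mutually_independent m n (X : 'I_n -> T -> 'cV[R]_m) : Prop :=
  forall (J : {set 'I_n}) (B : 'I_n -> set 'cV[R]_m),
    (forall j, borel_vec (B j)) ->
    Pr [set w | forall j, j \in J -> B j (X j w)] =
      (\prod_(j in J) Pr (X j @^-1` B j))%E.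

Definition identically_distributed m n (X : 'I_n -> T -> 'cV[R]_m) : Prop :=
  forall (j k : 'I_n) (B : set 'cV[R]_m),
    borel_vec B -> Pr (X j @^-1` B) = Pr (X k @^-1` B).

Definition iid m n (X : 'I_n -> T -> 'cV[R]_m) : Prop :=
  [/\ forall j, random_vec (X j), mutually_independent X
    & identically_distributed X].

Definition zero_mean m (X : T -> 'cV[R]_m) : Prop :=
  forall a : 'I_m, ('E_Pr[fun w => X w a 0%R] = 0)%E.

Definition has_covariance m (X : T -> 'cV[R]_m) (S : 'M[R]_m) : Prop :=
  forall a b : 'I_m,
    covariance Pr (fun w => X w a 0) (fun w => X w b 0) = (S a b)%:E.

End RandomVectors.

(* Main.v *)
Require Import Defs.
From HB Require Import structures.
From mathcomp Require Import all_boot all_order all_algebra.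
From mathcomp Require Import all_classical all_reals all_analysis.
From mathcomp Require Import measurable_realfun ring lra.

Import Order.TTheory GRing.Theory Num.Theory.
Import numFieldNormedType.Exports.

Local Open Scope classical_set_scope.
Local Open Scope ring_scope.

(** The marginal gain of sensor [i] at [S] is, by the Sherman-Morrison formula,
    [a |y|^2 / (1 + a <h_i, y>)] with [y = F_S^-1 h_i] and [a = 1 / sigma^2].  As
    soon as the Gram matrix [sum_j h_j h_j^T] is at most [t I], every [F_S] lies
    between [I / lambda_max(P)] and [(1 / lambda_min(P) + a t) I], so that two
    marginal gains of the same sensor differ by a factor at most
    [(kappa + t SNR)^3].

    For [t = c1 n / m] the Gram bound is a matrix Chernoff inequality, obtained
    here from powers instead of exponentials.  Let
    [D_k = I + (theta / N) sum_(j < k) h_j h_j^T].  For a symmetric [B >= I] the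
    moments [<g, B^j g>] are nondecreasing and log-convex in [j], which yields
    [tr (B + g g^T)^N <= tr B^N + N (1 + |g|^2)^N <g, B^N g>], a rank-one
    substitute for the Golden-Thompson inequality.  By independence,
    [E tr D_(k+1)^N <= (1 + theta e^(theta C) / m) E tr D_k^N]; Markov's
    inequality and a large [N] conclude. *)

(** * Rayleigh quotients *)

Section Dot.
Set Implicit Arguments.
Unset Strict Implicit.
Context {R : realType} {m : nat}.
Implicit Types (x y h : 'cV[R]_m) (A Q F : 'M[R]_m).

Definition dot x y : R := (x^T *m y) 0 0.

Lemma dotE x y : dot x y = \sum_i x i 0 * y i 0.
Proof. by rewrite /dot mxE; apply: eq_bigr => i _; rewrite mxE. Qed.

Lemma dotC x y : dot x y = dot y x.
Proof. by rewrite !dotE; apply: eq_bigr => i _; rewrite mulrC. Qed.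

Lemma dotDr x y z : dot x (y + z) = dot x y + dot x z.
Proof. by rewrite /dot mulmxDr mxE. Qed.

Lemma dotDl x y z : dot (x + y) z = dot x z + dot y z.
Proof. by rewrite dotC dotDr !(dotC z). Qed.

Lemma dotZr a x y : dot x (a *: y) = a * dot x y.
Proof. by rewrite /dot -scalemxAr mxE. Qed.

Lemma dotZl a x y : dot (a *: x) y = a * dot x y.
Proof. by rewrite dotC dotZr dotC. Qed.

Lemma dot0l x : dot 0 x = 0.
Proof. by rewrite /dot trmx0 mul0mx mxE. Qed.

Lemma dot_adj A x y : dot (A *m x) y = dot x (A^T *m y).
Proof. by rewrite /dot trmx_mul mulmxA. Qed.

Lemma dot_sumr (I : finType) (p : pred I) x (f : I -> 'cV[R]_m) :
  dot x (\sum_(i | p i) f i) = \sum_(i | p i) dot x (f i).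
Proof. by rewrite /dot mulmx_sumr summxE. Qed.

Lemma dot_sqnorm2 x : dot x x = sqnorm2 x.
Proof. by rewrite dotE; apply: eq_bigr => i _; rewrite expr2. Qed.

Lemma dot_ge0 x : 0 <= dot x x.
Proof. by rewrite dot_sqnorm2 sumr_ge0// => i _; exact: sqr_ge0. Qed.

Lemma dot_eq0 x : (dot x x == 0) = (x == 0).
Proof.
rewrite dot_sqnorm2 psumr_eq0 => [|i _]; last exact: sqr_ge0.
apply/allP/eqP => [x0|-> i _]; last by rewrite mxE expr0n /= eqxx.
apply/colP => i; rewrite mxE; apply/eqP.
by have := x0 i (mem_index_enum i); rewrite sqrf_eq0.
Qed.

Lemma dot_gt0 x : x != 0 -> 0 < dot x x.
Proof. by move=> x0; rewrite lt_neqAle dot_ge0 eq_sym dot_eq0 x0. Qed.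

Lemma mul_col_tr h x : h *m h^T *m x = dot h x *: h.
Proof.
rewrite -mulmxA; apply/colP => i; rewrite !mxE big_ord1 mulrC.
by rewrite /dot.
Qed.

Definition psd Q := Q^T = Q /\ forall x, 0 <= dot x (Q *m x).

Lemma psd_cauchy_schwarz Q x y : psd Q ->
  dot x (Q *m y) ^+ 2 <= dot x (Q *m x) * dot y (Q *m y).
Proof.
move=> [symQ Q0]; set a := dot x (Q *m x); set c := dot y (Q *m y).
set b := dot x (Q *m y).
have Qxy s t : 0 <= s ^+ 2 * a + s * t * b *+ 2 + t ^+ 2 * c.
  have := Q0 (s *: x + t *: y); rewrite mulmxDr -!scalemxAr.
  rewrite !(dotDl, dotDr, dotZl, dotZr) -[dot y (Q *m x)]dotC dot_adj symQ.
  rewrite -/a -/b -/c => /le_trans; apply; rewrite le_eqVlt; apply/orP; left.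
  by apply/eqP; ring.
have a0 : 0 <= a by exact: Q0.
have c0 : 0 <= c by exact: Q0.
(* The first two choices give [c * (a * c - b ^+ 2) >= 0] and the same with [a] in front; the third
   forces [b = 0] when both [a] and [c] vanish. *)
have := Qxy c (- b); have := Qxy (- b) a; have := Qxy 1 (- b).
move: a0 c0; rewrite !le_eqVlt => /predU1P[<-|a0] /predU1P[<-|c0]; nra.
Qed.

Lemma psd1 : psd 1%:M.
Proof. by split=> [|x]; rewrite ?trmx1// mul1mx dot_ge0. Qed.

Lemma cauchy_schwarz x y : dot x y ^+ 2 <= dot x x * dot y y.
Proof. by have := psd_cauchy_schwarz x y psd1; rewrite !mul1mx. Qed.

(** Cauchy-Schwarz on each row. The trace is the squared Frobenius norm, a crude stand-in for the
    squared operator norm. *)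
Lemma dot_mulmx_le Q x :
  dot (Q *m x) (Q *m x) <= \tr (Q *m Q^T) * dot x x.
Proof.
rewrite dotE /mxtrace mulr_suml; apply: ler_sum => i _.
rewrite -expr2 (_ : (Q *m x) i 0 = dot (row i Q)^T x); last first.
  by rewrite /dot trmxK !mxE; apply: eq_bigr => j _; rewrite mxE.
apply: (le_trans (cauchy_schwarz _ _)); rewrite ler_wpM2r ?dot_ge0//.
by rewrite dotE mxE; apply/ler_sum => j _; rewrite !mxE.
Qed.

Lemma unitmx_inj Q : (forall x, Q *m x = 0 -> x = 0) -> Q \in unitmx.
Proof.
move=> Q0; rewrite -unitmx_tr -row_free_unit -kermx_eq0.
apply/eqP/row_matrixP => i; rewrite row0.
have /(congr1 trmx) : (row i (kermx Q^T))^T = 0.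
  apply: Q0; set r := row _ _.
  have -> : Q *m r^T = (r *m Q^T)^T by rewrite trmx_mul trmxK.
  by rewrite -row_mul mulmx_ker row0 trmx0.
by rewrite trmxK trmx0.
Qed.

Lemma singular_kernel Q : Q \notin unitmx ->
  exists2 x : 'cV[R]_m, x != 0 & Q *m x = 0.
Proof.
apply: contraNP => nex; apply: unitmx_inj => x Qx.
by apply: contrapT => /eqP x0; apply: nex; exists x.
Qed.

(* Applied to [a I - Q] with [a] the supremum of the Rayleigh quotients of [Q],
   this shows that [a] is an eigenvalue without any compactness argument. *)
Lemma psd_unit_ge Q : psd Q -> Q \in unitmx ->
  exists2 e, 0 < e & forall x, e * dot x x <= dot x (Q *m x).
Proof.
move=> psdQ uQ; have [symQ Q0] := psdQ.
pose K := \tr (invmx Q *m (invmx Q)^T).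
have K1 : 0 < 1 + K.
  apply: ltr_pwDl => //; rewrite /K /mxtrace sumr_ge0// => i _.
  rewrite !mxE sumr_ge0// => j _; rewrite [_^T _ _]mxE -expr2; exact: sqr_ge0.
(* Expanding [|x - invmx Q x|^2 >= 0] bounds the form by the two squared norms, and [K] controls the
   second one. *)
have invK x : dot x (invmx Q *m x) <= (1 + K) * dot x x.
  have N2 := dot_mulmx_le (invmx Q) x.
  have := dot_ge0 (x - invmx Q *m x); rewrite -scaleN1r.
  rewrite !(dotDl, dotDr, dotZl, dotZr) (dotC _ x).
  have := dot_ge0 x; have := dot_ge0 (invmx Q *m x).
  nra.
exists (1 + K)^-1; first by rewrite invr_gt0.
move=> x; rewrite -ler_pdivlMl ?invr_gt0// invrK.
have [->|x0] := eqVneq x 0; first by rewrite mulmx0 dot0l mulr0.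
(* For the form of [Q], this reads [|x|^4 <= <x, Q x> <x, Q^-1 x>], which turns the upper bound on
   the inverse into a lower bound on [Q]. *)
have := psd_cauchy_schwarz x (invmx Q *m x) psdQ.
rewrite mulmxA mulmxV// mul1mx (dotC (_ *m _) x) => CS.
rewrite -(ler_pM2r (dot_gt0 x0)) -expr2; apply: (le_trans CS).
by rewrite [leRHS]mulrAC [leRHS]mulrC ler_wpM2l.
Qed.

Lemma eigenvalue_sym Q a : Q^T = Q ->
  eigenvalue Q a <-> exists2 x : 'cV[R]_m, x != 0 & Q *m x = a *: x.
Proof.
move=> symQ; split=> [/eigenvalueP[v vQ v0]|[x x0 Qx]].
  exists v^T; first by rewrite -(inj_eq (@trmx_inj _ _ _)) trmxK trmx0.
  by apply: trmx_inj; rewrite trmx_mul trmxK symQ vQ linearZ /= trmxK.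
apply/eigenvalueP; exists x^T; last first.
  by rewrite -(inj_eq (@trmx_inj _ _ _)) trmxK trmx0.
by rewrite -{1}symQ -trmx_mul Qx linearZ.
Qed.

(* The sign [e] covers both extreme Rayleigh quotients. *)
Lemma scalar_psd_eigen Q a e : Q^T = Q ->
  (forall x, 0 <= e * (a * dot x x - dot x (Q *m x))) -> e ^+ 2 = 1 ->
  (forall d, 0 < d -> exists2 x, x != 0 &
    e * (a * dot x x - dot x (Q *m x)) < d * dot x x) ->
  eigenvalue Q a.
Proof.
move=> symQ Qa e2 sharp; pose D := e *: (a%:M - Q).
have e0 : e != 0 by apply: contraTneq isT => e0; move: e2; rewrite e0; lra.
have DE x : dot x (D *m x) = e * (a * dot x x - dot x (Q *m x)).
  rewrite /D -scalemxAl dotZr mulmxBl mul_scalar_mx -[in LHS]scaleN1r.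
  by rewrite dotDr !dotZr mulN1r.
have psdD : psd D.
  split=> [|x]; last by rewrite DE.
  by rewrite /D linearZ /= linearB /= tr_scalar_mx symQ.
have [uD|] := boolP (D \in unitmx).
  have [d d0 dD] := psd_unit_ge psdD uD.
  have [x x0] := sharp d d0.
  by rewrite -DE ltNge dD.
move=> /singular_kernel[x x0 Dx]; apply/eigenvalue_sym => //; exists x => //.
move: Dx; rewrite /D -scalemxAl => /eqP; rewrite scaler_eq0 (negbTE e0) /=.
by rewrite mulmxBl mul_scalar_mx subr_eq0 => /eqP.
Qed.

End Dot.

Section Rayleigh.
Set Implicit Arguments.
Unset Strict Implicit.
Context {R : realType} {m : nat}.
Implicit Types (x y h : 'cV[R]_m) (P : 'M[R]_m).
Hypothesis m0 : (0 < m)%N.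

Let rayleigh P := [set dot x (P *m x) / dot x x | x in [set x | x != 0]].

Lemma rayleigh_nonempty P : rayleigh P !=set0.
Proof.
pose u : 'cV[R]_m := const_mx 1.
suff u0 : u != 0 by exists (dot u (P *m u) / dot u u), u.
apply/eqP => /colP/(_ (Ordinal m0)); rewrite !mxE => /eqP.
by rewrite oner_eq0.
Qed.

Lemma rayleigh_ubound P : psd P -> has_ubound (rayleigh P).
Proof.
move=> psdP; have [symP P0] := psdP.
exists (1 + \tr (P *m P)) => _ [x /= x0 <-].
rewrite ler_pdivrMr ?dot_gt0//.
have := dot_mulmx_le P x; rewrite symP => N2.
have := dot_ge0 (x - P *m x); rewrite -scaleN1r.
rewrite !(dotDl, dotDr, dotZl, dotZr) (dotC _ x).
have := dot_ge0 x; have := dot_ge0 (P *m x).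
nra.
Qed.

Lemma rayleigh_sup_eigenvalue P : psd P -> eigenvalue P (sup (rayleigh P)).
Proof.
move=> psdP; have [symP P0] := psdP.
have hs : has_sup (rayleigh P).
  by split; [exact: rayleigh_nonempty|exact: rayleigh_ubound].
apply: (@scalar_psd_eigen _ _ P _ 1) => //; last 2 first.
- by rewrite expr1n.
- move=> d d0; have [_ [x /= x0 <-]] := sup_adherent d0 hs.
  rewrite ltr_pdivlMr ?dot_gt0// => dx; exists x => //; nra.
move=> x; rewrite mul1r subr_ge0.
have [->|x0] := eqVneq x 0; first by rewrite mulmx0 dot0l mulr0.
rewrite -ler_pdivrMr ?dot_gt0//; apply: ub_le_sup; first exact: hs.2.
by exists x.
Qed.

Lemma rayleigh_inf_eigenvalue P : psd P -> eigenvalue P (inf (rayleigh P)).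
Proof.
move=> psdP; have [symP P0] := psdP.
have hi : has_inf (rayleigh P).
  split; [exact: rayleigh_nonempty|exists 0 => _ [x _ <-]].
  by rewrite divr_ge0// dot_ge0.
apply: (@scalar_psd_eigen _ _ P _ (-1)) => //; last 2 first.
- by rewrite sqrrN expr1n.
- move=> d d0; have [_ [x /= x0 <-]] := inf_adherent d0 hi.
  rewrite ltr_pdivrMr ?dot_gt0// => dx; exists x => //; nra.
move=> x; rewrite mulN1r oppr_ge0 subr_le0.
have [->|x0] := eqVneq x 0; first by rewrite mulmx0 dot0l mulr0.
rewrite -ler_pdivlMr ?dot_gt0//; apply: ge_inf; first exact: hi.2.
by exists x.
Qed.

Lemma posdefmx_psd P : posdefmx P -> psd P.
Proof.
move=> [symP P0]; split=> // x; rewrite /dot mulmxA.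
have [->|x0] := eqVneq x 0; first by rewrite mulmx0 mxE.
exact/ltW/P0.
Qed.

Lemma eigenvalue_rayleigh P a : P^T = P -> eigenvalue P a -> rayleigh P a.
Proof.
move=> symP /(eigenvalue_sym _ symP)[x x0 Px]; exists x => //.
by rewrite Px dotZr mulfK// dot_eq0.
Qed.

(** The supremum of the Rayleigh quotients is itself an eigenvalue, hence at most [lambda_max P].
    Eigenvalues are Rayleigh quotients, so their set is bounded. *)
Lemma lambda_max_ge P x : posdefmx P ->
  dot x (P *m x) <= lambda_max P * dot x x.
Proof.
move=> hP; have psdP := posdefmx_psd hP; have [symP _] := psdP.
have [->|x0] := eqVneq x 0; first by rewrite mulmx0 dot0l mulr0.
rewrite -ler_pdivrMr ?dot_gt0//.
have [M MP] := rayleigh_ubound psdP.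
apply: (@le_trans _ _ (sup (rayleigh P))).
  by apply: ub_le_sup; [exists M|exists x].
apply: ub_le_sup; last exact: rayleigh_sup_eigenvalue.
by exists M => a /(eigenvalue_rayleigh symP)/MP.
Qed.

Lemma lambda_min_le P x : posdefmx P ->
  lambda_min P * dot x x <= dot x (P *m x).
Proof.
move=> hP; have psdP := posdefmx_psd hP; have [symP P0] := psdP.
have [->|x0] := eqVneq x 0; first by rewrite mulmx0 dot0l mulr0.
rewrite -ler_pdivlMr ?dot_gt0//.
have lb : lbound (rayleigh P) 0.
  by move=> _ [y _ <-]; rewrite divr_ge0// dot_ge0.
apply: (@le_trans _ _ (inf (rayleigh P))).
  apply: ge_inf; last exact: rayleigh_inf_eigenvalue.
  by exists 0 => a /(eigenvalue_rayleigh symP)/lb.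
by apply: ge_inf; [exists 0|exists x].
Qed.

(** The infimum of the Rayleigh quotients is an eigenvalue, so it is attained at a nonzero vector
    and is positive. *)
Lemma lambda_min_gt0 P : posdefmx P -> 0 < lambda_min P.
Proof.
move=> hP; have psdP := posdefmx_psd hP; have [symP P0] := psdP.
have e := rayleigh_inf_eigenvalue psdP.
apply: (@lt_le_trans _ _ (inf (rayleigh P))).
  have [x x0 <-] := eigenvalue_rayleigh symP e.
  by rewrite divr_gt0 ?dot_gt0// /dot mulmxA; exact: hP.2.
apply: lb_le_inf; first by exists (inf (rayleigh P)).
move=> a /(eigenvalue_rayleigh symP) ra; apply: ge_inf => //.
by exists 0 => _ [y _ <-]; rewrite divr_ge0// dot_ge0.
Qed.

End Rayleigh.

(** * Marginal gains *)

Section InverseBounds.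
Set Implicit Arguments.
Unset Strict Implicit.
Context {R : realType} {m : nat}.
Implicit Types (x y h : 'cV[R]_m).
Variables (F : 'M[R]_m) (l u : R).
Hypotheses (l0 : 0 < l) (symF : F^T = F).
Hypothesis F_ge : forall x, l * dot x x <= dot x (F *m x).
Hypothesis F_le : forall x, dot x (F *m x) <= u * dot x x.

Lemma bounded_below_psd : psd F.
Proof.
by split=> // x; apply: le_trans (F_ge x); rewrite mulr_ge0 ?dot_ge0// ltW.
Qed.

Lemma bounded_below_unitmx : F \in unitmx.
Proof.
apply: unitmx_inj => x Fx0; apply/eqP; rewrite -dot_eq0 eq_le dot_ge0 andbT.
have := F_ge x; rewrite Fx0 (_ : dot x 0 = 0) ?pmulr_rle0//.
by rewrite /dot mulmx0 mxE.
Qed.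

Lemma mul_invmx_col h : F *m (invmx F *m h) = h.
Proof. by rewrite mulmxA mulmxV ?bounded_below_unitmx// mul1mx. Qed.

Lemma inv_form_ge0 h : 0 <= dot h (invmx F *m h).
Proof.
by rewrite -{1}(mul_invmx_col h) dot_adj symF; exact: bounded_below_psd.2.
Qed.

(** This and the next three lemmas transfer [l I <= F <= u I] to [y = F^-1 h] without diagonalizing
    [F]. Here [<h, y>^2 <= |h|^2 |y|^2] is combined with [l |y|^2 <= <y, F y> = <h, y>]. *)
Lemma inv_form_le h : l * dot h (invmx F *m h) <= dot h h.
Proof.
have := inv_form_ge0 h; rewrite le_eqVlt => /predU1P[<-|q0].
  by rewrite mulr0 dot_ge0.
rewrite -(ler_pM2r q0) -mulrA -expr2.
apply: le_trans (ler_wpM2l (ltW l0) (cauchy_schwarz _ _)) _.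
rewrite mulrCA ler_wpM2l ?dot_ge0//; apply: le_trans (F_ge _) _.
by rewrite mul_invmx_col dotC.
Qed.

Lemma inv_norm_le h :
  l ^+ 2 * dot (invmx F *m h) (invmx F *m h) <= dot h h.
Proof.
have := inv_form_le h; have := F_ge (invmx F *m h).
rewrite mul_invmx_col (dotC _ h) => q /(le_trans _); apply.
by rewrite expr2 -mulrA ler_pM2l.
Qed.

(** Cauchy-Schwarz for the form of [F] gives [|h|^4 <= <h, F h> <y, F y>], where [F y = h] and
    [<h, F h> <= u |h|^2]. *)
Lemma inv_form_ge h : dot h h <= u * dot h (invmx F *m h).
Proof.
have [->|/dot_gt0 h0] := eqVneq h 0.
  by rewrite mulmx0 dot0l mulr0.
rewrite -(ler_pM2l h0) mulrA (mulrC _ u).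
have := psd_cauchy_schwarz h (invmx F *m h) bounded_below_psd.
rewrite mul_invmx_col (dotC _ h) -expr2 => /le_trans; apply.
by rewrite ler_wpM2r ?inv_form_ge0.
Qed.

Lemma inv_norm_ge h :
  dot h h <= u ^+ 2 * dot (invmx F *m h) (invmx F *m h).
Proof.
have [->|h0] := eqVneq h 0.
  by rewrite mulmx0 dot0l mulr0.
have u0 : 0 <= u.
  rewrite -(pmulr_lge0 _ (dot_gt0 h0)).
  by apply: le_trans (F_le h); exact: bounded_below_psd.2.
have := inv_form_ge h; have := F_le (invmx F *m h).
rewrite mul_invmx_col (dotC _ h) => q /le_trans; apply.
by rewrite expr2 -mulrA ler_wpM2l.
Qed.

(** The updated inverse is [F^-1 - c y y^T] with [c = a / (1 + a <h, y>)], and [y y^T] has trace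
    [|y|^2]. *)
Lemma sherman_morrison_trace a h : 0 <= a ->
  \tr (invmx F) - \tr (invmx (F + a *: (h *m h^T))) =
  a * dot (invmx F *m h) (invmx F *m h) / (1 + a * dot h (invmx F *m h)).
Proof.
move=> a0; set y := invmx F *m h.
have uF := bounded_below_unitmx.
have Fy : F *m y = h by rewrite mulmxA mulmxV// mul1mx.
have s0 : 0 <= dot h y by exact: inv_form_ge0.
set s := dot h y; set c := a / (1 + a * s).
have as0 : 1 + a * s != 0 by rewrite gt_eqF// ltr_pwDl// mulr_ge0.
have yE : y^T = h^T *m invmx F by rewrite trmx_mul trmx_inv symF.
(* Off the identity, every term is a multiple of [h y^T]; the total coefficient [a - c - a c s]
   vanishes by the choice of [c]. *)
have FK : (F + a *: (h *m h^T)) *m (invmx F - c *: (y *m y^T)) = 1%:M.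
  rewrite mulmxDl !mulmxBr mulmxV// -!scalemxAr -!scalemxAl.
  rewrite (mulmxA F) Fy -(mulmxA h) -yE (mulmxA _ y) mul_col_tr -/s -scalemxAl.
  rewrite -addrA -[RHS]addr0; congr (_ + _).
  rewrite !scalerA -scaleNr -scalerBl -scalerDl; apply/eqP; rewrite scaler_eq0.
  by apply/orP; left; apply/eqP; rewrite /c; field.
have -> : invmx (F + a *: (h *m h^T)) = invmx F - c *: (y *m y^T).
  have [uFa _] := mulmx1_unit FK.
  by rewrite -[RHS](mulKmx uFa) FK mulmx1.
rewrite linearB /= linearZ /= mxtrace_mulC /mxtrace big_ord1 -/(dot y y).
by rewrite opprB addrC subrK /c mulrAC.
Qed.

End InverseBounds.

Section CurvatureBound.
Set Implicit Arguments.
Unset Strict Implicit.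
Context {R : realType} {m n : nat}.
Implicit Types (x y : 'cV[R]_m) (P : 'M[R]_m) (h : 'I_n -> 'cV[R]_m).
Hypothesis m0 : (0 < m)%N.
Variables (P : 'M[R]_m) (s2 : R).
Hypotheses (hP : posdefmx P) (s20 : 0 < s2).
Variables (h : 'I_n -> 'cV[R]_m) (sigma2 : 'I_n -> R).
Hypothesis hsigma2 : forall j, sigma2 j = s2.
Implicit Types A B S : {set 'I_n}.

Lemma lambda_max_gt0 : 0 < lambda_max P.
Proof.
pose v : 'cV[R]_m := const_mx 1.
have v0 : v != 0.
  apply/eqP => /colP/(_ (Ordinal m0)); rewrite !mxE => /eqP.
  by rewrite oner_eq0.
rewrite -(pmulr_lgt0 _ (dot_gt0 v0)); apply: lt_le_trans (lambda_max_ge m0 _ hP).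
by rewrite /dot mulmxA; exact: hP.2.
Qed.

Lemma gram_form S x :
  dot x ((\sum_(i in S) h i *m (h i)^T) *m x) = \sum_(i in S) dot (h i) x ^+ 2.
Proof.
rewrite mulmx_suml dot_sumr; apply: eq_bigr => i _.
by rewrite mul_col_tr dotZr (dotC x) expr2.
Qed.

Lemma FmxE S :
  Fmx P h sigma2 S = invmx P + s2^-1 *: \sum_(i in S) h i *m (h i)^T.
Proof.
rewrite /Fmx scaler_sumr; congr (_ + _).
by apply: eq_bigr => i _; rewrite hsigma2.
Qed.

Lemma Fmx_sym S : (Fmx P h sigma2 S)^T = Fmx P h sigma2 S.
Proof.
rewrite FmxE linearD /= linearZ /= trmx_inv hP.1 linear_sum /=.
by congr (_ + _ *: _); apply: eq_bigr => i _; rewrite trmx_mul trmxK.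
Qed.

(** [P <= lambda_max(P) I] is inverted, and the sensor terms only add nonnegative squares. *)
Lemma Fmx_ge S x :
  (lambda_max P)^-1 * dot x x <= dot x (Fmx P h sigma2 S *m x).
Proof.
rewrite FmxE mulmxDl dotDr -[leLHS]addr0 lerD//.
  rewrite ler_pdivrMl ?lambda_max_gt0//.
  by apply: (inv_form_ge (lambda_min_gt0 m0 hP) hP.1) => y;
    [exact: lambda_min_le|exact: lambda_max_ge].
rewrite -scalemxAl dotZr gram_form mulr_ge0//; first by rewrite invr_ge0 ltW.
by rewrite sumr_ge0// => i _; exact: sqr_ge0.
Qed.

Lemma Fmx_unit S : Fmx P h sigma2 S \in unitmx.
Proof.
apply: (@bounded_below_unitmx _ _ _ (lambda_max P)^-1).
- by rewrite invr_gt0 lambda_max_gt0.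
- exact: Fmx_ge.
Qed.

Lemma marginal_mse_gain S i : i \notin S ->
  let y := invmx (Fmx P h sigma2 S) *m h i in
  marginal (mse_gain P h sigma2) i S =
    s2^-1 * dot y y / (1 + s2^-1 * dot (h i) y).
Proof.
move=> iS y; rewrite /y -(@sherman_morrison_trace _ _ _ (lambda_max P)^-1).
- rewrite /marginal /mse_gain {1}/Fmx big_setU1//= hsigma2 -/(Fmx _ _ _ _).
  rewrite [X in invmx (_ + X)]addrC addrA -/(Fmx P h sigma2 S).
  by rewrite !linearB /=; ring.
- by rewrite invr_gt0 lambda_max_gt0.
- exact: Fmx_sym.
- exact: Fmx_ge.
- by rewrite invr_ge0 ltW.
Qed.

Let inv_form_ge0 S x : 0 <= dot x (invmx (Fmx P h sigma2 S) *m x).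
Proof.
apply: (@inv_form_ge0 _ _ _ (lambda_max P)^-1) => //.
- by rewrite invr_gt0 lambda_max_gt0.
- exact: Fmx_sym.
- exact: Fmx_ge.
Qed.

Lemma marginal_mse_gain_ge0 S i : i \notin S ->
  0 <= marginal (mse_gain P h sigma2) i S.
Proof.
move=> iS; rewrite marginal_mse_gain//.
have s2V : 0 <= s2^-1 by rewrite invr_ge0 ltW.
by rewrite divr_ge0 ?mulr_ge0 ?dot_ge0// addr_ge0// mulr_ge0.
Qed.

(** Whether a gain vanishes does not depend on [S], so a zero denominator in the curvature always
    comes with a zero numerator. *)
Lemma marginal_mse_gain_eq0 S i : i \notin S ->
  (marginal (mse_gain P h sigma2) i S == 0) = (h i == 0).
Proof.
move=> iS; rewrite marginal_mse_gain//.
have s2V : 0 < s2^-1 by rewrite invr_gt0.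
rewrite !mulf_eq0 gt_eqF// invr_eq0 dot_eq0 [_ + _ == 0]gt_eqF ?orbF; last first.
  by rewrite ltr_pwDl// mulr_ge0// ltW.
apply/eqP/eqP => [|->]; last by rewrite mulmx0.
move/(congr1 (mulmx (Fmx P h sigma2 S))).
by rewrite mulmxA mulmxV ?Fmx_unit// mul1mx mulmx0.
Qed.

Variable t : R.
Hypothesis gram_le : forall x,
  dot x ((\sum_j h j *m (h j)^T) *m x) <= t * dot x x.

Lemma Fmx_le S x :
  dot x (Fmx P h sigma2 S *m x) <= ((lambda_min P)^-1 + t / s2) * dot x x.
Proof.
rewrite FmxE mulmxDl dotDr mulrDl lerD//.
  rewrite ler_pdivlMl ?lambda_min_gt0//.
  by apply: (inv_form_le (lambda_min_gt0 m0 hP) hP.1) => y; exact: lambda_min_le.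
rewrite -scalemxAl dotZr mulrAC mulrC ler_wpM2r//; first by rewrite invr_ge0 ltW.
apply: le_trans (gram_le x); rewrite gram_form.
(* The full Gram form is a sum of squares over all sensors; restricting it to [S] can only decrease
   it. *)
have -> : \sum_j h j *m (h j)^T = \sum_(j in [set: 'I_n]%SET) h j *m (h j)^T.
  by apply: eq_bigl => j; rewrite inE.
rewrite gram_form [leLHS]big_mkcond [leRHS]big_mkcond; apply: ler_sum => j _.
by rewrite inE; case: ifP => // _; exact: sqr_ge0.
Qed.

(** With [L = lambda_max P] and [u] the upper bound on [F], the numerators [|y|^2] contribute a
    factor [(L u)^2] and the denominators a factor [L u]. *)
Lemma marginal_ratio A B i : i \notin A -> i \notin B ->
  marginal (mse_gain P h sigma2) i B <=
  (kappa P + t * SNR P s2) ^+ 3 * marginal (mse_gain P h sigma2) i A.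
Proof.
move=> iA iB; rewrite !marginal_mse_gain//.
set yB := invmx _ *m _; set yA := invmx _ *m _.
have L0 := lambda_max_gt0; have LV0 : 0 < (lambda_max P)^-1 by rewrite invr_gt0.
have -> : kappa P + t * SNR P s2 =
    lambda_max P * ((lambda_min P)^-1 + t / s2).
  by rewrite /kappa /SNR mulrDr; congr (_ + _); rewrite mulrCA.
set u := (lambda_min P)^-1 + t / s2; set L := lambda_max P in L0 LV0 *.
have s2V : 0 < s2^-1 by rewrite invr_gt0.
have qA : dot (h i) yA <= L * dot (h i) (h i).
  rewrite -ler_pdivrMl//.
  by apply: inv_form_le LV0 (Fmx_sym _) _ _; exact: Fmx_ge.
have nB : dot yB yB <= L ^+ 2 * dot (h i) (h i).
  rewrite -ler_pdivrMl ?exprn_gt0// -exprVn.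
  by apply: inv_norm_le LV0 (Fmx_sym _) _ _; exact: Fmx_ge.
have qB : dot (h i) (h i) <= u * dot (h i) yB.
  by apply: inv_form_ge LV0 (Fmx_sym _) _ _ _; [exact: Fmx_ge|exact: Fmx_le].
have nA : dot (h i) (h i) <= u ^+ 2 * dot yA yA.
  by apply: inv_norm_ge LV0 (Fmx_sym _) _ _ _; [exact: Fmx_ge|exact: Fmx_le].
have qA0 : 0 <= dot (h i) yA by exact: inv_form_ge0.
have qB0 : 0 <= dot (h i) yB by exact: inv_form_ge0.
have [hi0|hi0] := eqVneq (h i) 0.
  by rewrite /yA /yB hi0 !mulmx0 /dot trmx0 !mul0mx !mxE !(mulr0, mul0r).
have hh := dot_gt0 hi0.
(* Both bounds on a single [F] are compared at [h i]. This absorbs the summand 1 of the denominators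
   in [DAB]. *)
have Lu1 : 1 <= L * u.
  rewrite -ler_pdivrMl// mulr1 -(ler_pM2r hh).
  by apply: le_trans (Fmx_ge A _) (Fmx_le A _).
have DA : 0 < 1 + s2^-1 * dot (h i) yA by rewrite ltr_pwDl// mulr_ge0// ltW.
have DB : 0 < 1 + s2^-1 * dot (h i) yB by rewrite ltr_pwDl// mulr_ge0// ltW.
have nBA : dot yB yB <= (L * u) ^+ 2 * dot yA yA.
  by apply: (le_trans nB); rewrite exprMn -(mulrA (L ^+ 2)) ler_pM2l ?exprn_gt0.
have DAB : 1 + s2^-1 * dot (h i) yA <= L * u * (1 + s2^-1 * dot (h i) yB).
  rewrite mulrDr mulr1 lerD// mulrCA ler_pM2l// -mulrA.
  by apply: (le_trans qA); rewrite ler_pM2l.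
rewrite ler_pdivrMr//.
set DA' := 1 + _ * dot _ yA in DA DAB *.
set DB' := 1 + _ * dot _ yB in DB DAB *.
have -> : (L * u) ^+ 3 * (s2^-1 * dot yA yA / DA') * DB' =
    s2^-1 * ((L * u) ^+ 3 * dot yA yA * DB') / DA' by ring.
rewrite ler_pdivlMr// -(mulrA s2^-1) ler_pM2l//.
apply: le_trans (ler_pM (dot_ge0 yB) (ltW DA) nBA DAB) _.
by rewrite le_eqVlt; apply/orP; left; apply/eqP; ring.
Qed.

End CurvatureBound.

(** * Traces of powers under rank-one updates *)

Section Powers.
Set Implicit Arguments.
Unset Strict Implicit.
Context {R : realType}.

(** Log-convexity makes the quotients [b k.+1 / b k] nondecreasing. Both [b k / b 0] and
    [b (j + k) / b j] are products of [k] such quotients, the latter at larger indices. *)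
Lemma log_convex_mul_le (b : nat -> R) : (forall k, 0 < b k) ->
  (forall k, b k.+1 ^+ 2 <= b k * b k.+2) ->
  forall j k, b j * b k <= b 0%N * b (j + k)%N.
Proof.
move=> b0 lc j k.
have ratio i l : b i.+1 * b (i + l)%N <= b i * b (i + l).+1.
  elim: l => [|l IH]; first by rewrite addn0 mulrC.
  rewrite addnS -(ler_pM2r (b0 (i + l)%N)) mulrAC.
  apply: le_trans (ler_wpM2r (ltW (b0 _)) IH) _.
  by rewrite -!mulrA ler_pM2l// -expr2 [leRHS]mulrC.
elim: k => [|k IH]; first by rewrite addn0 mulrC.
rewrite addnS -(ler_pM2r (b0 k)) mulrAC.
apply: le_trans (ler_wpM2r (ltW (b0 _)) IH) _.
by rewrite -!mulrA ler_pM2l// [leRHS]mulrC [leLHS]mulrC addnC; exact: ratio.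
Qed.

Context {m : nat}.
Implicit Types (x y h : 'cV[R]_m) (B : 'M[R]_m).

(** The Loewner order [I <= B] for symmetric [B]. *)
Definition id_le B := B^T = B /\ forall x, dot x x <= dot x (B *m x).

Lemma mulmx_exprS B k x : B ^+ k.+1 *m x = B *m (B ^+ k *m x).
Proof. by rewrite exprS mulmxA. Qed.

Lemma mulmx_exprSr B k x : B ^+ k.+1 *m x = B ^+ k *m (B *m x).
Proof. by rewrite exprSr mulmxA. Qed.

Lemma trmx_expr B k : B^T = B -> (B ^+ k)^T = B ^+ k.
Proof.
move=> symB; elim: k => [|k IH]; first exact: trmx1.
by rewrite [in LHS]exprS [LHS]trmx_mul IH symB exprSr.
Qed.

Lemma dot_expr_bounds B k x : id_le B ->
  0 <= dot x (B ^+ k *m x) <= dot x (B ^+ k.+1 *m x).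
Proof.
move=> [symB B1].
have P0 y : 0 <= dot y (B ^+ 0 *m y) <= dot y (B ^+ 1 *m y).
  by rewrite expr0 mul1mx expr1 dot_ge0 B1.
have PSS l y : dot y (B ^+ l.+2 *m y) = dot (B *m y) (B ^+ l *m (B *m y)).
  by rewrite dot_adj symB mulmx_exprS mulmx_exprSr.
(* [|B y|^2 >= 2 <y, B y> - |y|^2 >= <y, B y>]. With [P0] this starts an induction in steps of two,
   where [PSS] moves one factor [B] onto each argument. *)
have P1 y : 0 <= dot y (B ^+ 1 *m y) <= dot y (B ^+ 2 *m y).
  rewrite PSS expr0 mul1mx expr1 (le_trans (dot_ge0 y)) ?B1//=.
  have := dot_ge0 (y - B *m y); rewrite -scaleN1r.
  rewrite !(dotDl, dotDr, dotZl, dotZr) (dotC (B *m y) y); have := B1 y; lra.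
elim/ltn_ind: k x => -[//|[//|k]] IH x.
by rewrite !PSS IH.
Qed.

Lemma expr_psd B k : id_le B -> psd (B ^+ k).
Proof.
move=> B1; split=> [|x]; first exact/trmx_expr/B1.1.
by have /andP[] := dot_expr_bounds k x B1.
Qed.

Lemma dot_expr_gt0 B k x : id_le B -> x != 0 -> 0 < dot x (B ^+ k *m x).
Proof.
move=> B1 x0; elim: k => [|k IH].
  by rewrite expr0 mul1mx dot_gt0.
by apply: lt_le_trans IH _; have /andP[] := dot_expr_bounds k x B1.
Qed.

(** The moments are log-convex by Cauchy-Schwarz for the form of [B ^+ i] at [x] and [B x]. *)
Lemma dot_expr_mul_le B j k x : id_le B ->
  dot x (B ^+ j *m x) * dot x (B ^+ k *m x) <=
  dot x x * dot x (B ^+ (j + k) *m x).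
Proof.
move=> B1; have [->|x0] := eqVneq x 0; first by rewrite !dot0l !mul0r.
have -> : dot x x = dot x (B ^+ 0 *m x).
  by rewrite expr0 mul1mx.
apply: (@log_convex_mul_le (fun k => dot x (B ^+ k *m x))) => i.
  exact: dot_expr_gt0.
rewrite mulmx_exprSr; apply: le_trans (psd_cauchy_schwarz _ _ (expr_psd i B1)) _.
by rewrite -mulmx_exprSr dot_adj B1.1 -mulmx_exprS.
Qed.

(** Jensen's inequality for the power [k] under the spectral measure of [x], cleared of
    denominators; each induction step uses the moment inequality with [j = 1]. *)
Lemma dot_expr_le B k x : id_le B ->
  dot x (B *m x) ^+ k * dot x x <= dot x x ^+ k * dot x (B ^+ k *m x).
Proof.
move=> B1; elim: k => [|k IH].
  by rewrite !expr0 mul1mx.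
have B0 := le_trans (dot_ge0 x) (B1.2 x).
rewrite exprS -mulrA; apply: le_trans (ler_wpM2l B0 IH) _.
rewrite mulrCA exprSr -[leRHS]mulrA ler_wpM2l ?exprn_ge0 ?dot_ge0//.
by have := dot_expr_mul_le 1 k x B1; rewrite expr1.
Qed.

(** The trace of an even power controls the Rayleigh quotients: [<x, B^(2k) x> = |B^k x|^2], and
    [tr B^(2k)] is the squared Frobenius norm of [B^k]. *)
Lemma dot_le_trace_expr B k x : id_le B -> x != 0 ->
  dot x (B *m x) ^+ k.*2 <= \tr (B ^+ k.*2) * dot x x ^+ k.*2.
Proof.
move=> B1 /dot_gt0 x0.
rewrite -(ler_pM2r x0); apply: le_trans (dot_expr_le _ _ B1) _.
rewrite -mulrA (mulrCA (\tr _)) ler_wpM2l ?exprn_ge0 ?dot_ge0//.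
rewrite -addnn exprD -mulmxE -mulmxA.
have := dot_mulmx_le (B ^+ k) x.
by rewrite dot_adj trmx_expr ?B1.1.
Qed.

(** One factor [B + h h^T] is expanded at a time. Its [B] part raises [j]; its rank-one part splits
    off [<h, B^j h>], which the moment inequality merges back at the cost of a factor [|h|^2]. *)
Lemma dot_rank1_expr_le B h j k : id_le B ->
  dot h (B ^+ j *m ((B + h *m h^T) ^+ k *m h)) <=
  (1 + dot h h) ^+ k * dot h (B ^+ (j + k) *m h).
Proof.
move=> B1; have h0 := dot_ge0 h.
have h1 : 0 <= (1 + dot h h) by rewrite addr_ge0.
elim: k j => [|k IH] j.
  by rewrite !expr0 mul1r addn0 mul1mx.
rewrite mulmx_exprS mulmxDl mul_col_tr mulmxDr dotDr -scalemxAr dotZr.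
rewrite -mulmx_exprSr (exprS (1 + _)) -mulrA mulrDl mul1r lerD//.
  by rewrite addnS -addSn; exact: IH.
have /andP[bj0 _] := dot_expr_bounds j h B1.
have := IH 0%N; rewrite expr0 mul1mx add0n => /(ler_wpM2r bj0)/le_trans; apply.
rewrite -mulrA [leRHS]mulrCA ler_wpM2l ?exprn_ge0//.
apply: le_trans (dot_expr_mul_le _ _ _ B1) _; rewrite ler_wpM2l// addnC addnS.
by have /andP[] := dot_expr_bounds (j + k) h B1.
Qed.

Lemma mxtrace_col_row x y : \tr (x *m y^T) = dot y x.
Proof. by rewrite mxtrace_mulC /mxtrace big_ord1. Qed.

(** The factors [B + h h^T] are replaced by [B] one after the other; each of the [k] replacements
    costs a form bounded by the previous lemma and by monotonicity of the moments. *)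
Lemma trace_rank1_expr_le B h k : id_le B ->
  \tr ((B + h *m h^T) ^+ k) <=
  \tr (B ^+ k) + k%:R * (1 + dot h h) ^+ k * dot h (B ^+ k *m h).
Proof.
move=> B1; have h0 := dot_ge0 h.
have h1 : 0 <= (1 + dot h h) by rewrite addr_ge0.
(* The prefix [B ^+ j] collects the factors already replaced. *)
suff H j : \tr (B ^+ j *m (B + h *m h^T) ^+ k) <=
    \tr (B ^+ (j + k)) + k%:R * (1 + dot h h) ^+ k * dot h (B ^+ (j + k) *m h).
  by have := H 0%N; rewrite expr0 mul1mx.
elim: k j => [|k IH] j.
  by rewrite !expr0 addn0 mulmx1 !mul0r addr0.
set D := B + h *m h^T in IH *.
have symD : D^T = D by rewrite /D linearD /= trmx_mul trmxK B1.1.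
have -> : \tr (B ^+ j *m D ^+ k.+1) =
    \tr (B ^+ j.+1 *m D ^+ k) + dot h (B ^+ j *m (D ^+ k *m h)).
  rewrite (exprS D) (exprSr B) -!mulmxE mulmxA {2}/D mulmxDr mulmxDl linearD /=.
  congr (_ + _); rewrite -[D ^+ k in LHS](trmx_expr k symD) !mulmxA.
  rewrite -mulmxA -trmx_mul mxtrace_col_row dotC dot_adj.
  by rewrite trmx_expr ?B1.1 ?mulmxA.

have /andP[_ bS] := dot_expr_bounds (j + k) h B1.
have /andP[bS0 _] := dot_expr_bounds (j + k).+1 h B1.
apply: le_trans (lerD (IH _) (dot_rank1_expr_le _ _ _ B1)) _.
rewrite addnS addSn -addrA lerD2l -natr1 -mulrA -[leRHS]mulrA mulrDl mul1r.
have hk : (1 + dot h h) ^+ k <= (1 + dot h h) ^+ k.+1.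
  by rewrite exprS ler_peMl ?exprn_ge0// lerDl.
rewrite lerD//; first by rewrite ler_wpM2l// ler_wpM2r.
apply: ler_pM => //; first exact: exprn_ge0.
by have /andP[] := dot_expr_bounds (j + k) h B1.
Qed.

End Powers.

(** * Independence and measurability *)

Section Decoupling.
Set Implicit Arguments.
Unset Strict Implicit.
Context {d : measure_display} {T : measurableType d} {R : realType}.
Variable Pr : probability T R.
Implicit Types (G : set (set T)) (A B : set T).

(** As functions of [A], both sides are finite measures that agree on the pi-system [G], hence on
    the sigma-algebra it generates. *)
Lemma indep_sigma G B : measurable B -> G `<=` measurable -> setI_closed G ->
  G setT -> (forall A, G A -> Pr (A `&` B) = Pr A * Pr B)%E ->
  forall A, <<s G >> A -> Pr (A `&` B) = (Pr A * Pr B)%E.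
Proof.
move=> mB Gm GI GT GB A sA.
have PB0 : 0 <= fine (Pr B) by exact: fine_ge0.
have cover : \bigcup_(k in [set: nat]) [set: T] = setT.
  by rewrite bigcup_const//; exists 0%N.
have mscaleE C : mscale (NngNum PB0) Pr C = (Pr C * Pr B)%E.
  rewrite /mscale [LHS]muleC; congr (_ * _)%E.
  by rewrite /= fineK ?fin_num_measure.
rewrite -mscaleE -[LHS]/(mrestr Pr mB A).
apply: (g_sigma_algebra_measure_unique G Gm (fun=> setT) (fun=> GT)) => //.
  by move=> C /GB GC; exact: etrans GC (esym (mscaleE C)).
move=> k; rewrite -[X in (X < _)%E]/(Pr (setT `&` B)) setTI.
by rewrite (le_lt_trans (probability_le1 _ _))// ltry.
Qed.

(** Factorization on rectangles identifies the law of [(X, Y)] with the product of the two laws.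
    Tonelli's theorem applies there, and each integral is pulled back to [T]. *)
Lemma decoupling {d1 d2} {T1 : measurableType d1} {T2 : measurableType d2}
    (X : T -> T1) (Y : T -> T2) (F : T1 * T2 -> \bar R) :
  measurable_fun setT X -> measurable_fun setT Y ->
  (forall (A : set T1) (B : set T2), measurable A -> measurable B ->
    Pr (X @^-1` A `&` Y @^-1` B) = Pr (X @^-1` A) * Pr (Y @^-1` B))%E ->
  measurable_fun setT F -> (forall z, 0 <= F z)%E ->
  (\int[Pr]_w F (X w, Y w) = \int[Pr]_x \int[Pr]_y F (X x, Y y))%E.
Proof.
move=> mX mY ind mF F0.
have mXY : measurable_fun setT (fun w => (X w, Y w)).
  exact: measurable_fun_pair.
pose X' : {mfun T >-> T1} := HB.pack X (isMeasurableFun.Build _ _ _ _ _ mX).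
pose Y' : {mfun T >-> T2} := HB.pack Y (isMeasurableFun.Build _ _ _ _ _ mY).
pose XY : {mfun T >-> (T1 * T2)%type} :=
  HB.pack (fun w => (X w, Y w)) (isMeasurableFun.Build _ _ _ _ _ mXY).
have prodE : (\int[distribution Pr XY]_z F z =
    \int[distribution Pr X' \x distribution Pr Y']_z F z)%E.
  apply: eq_measure_integral => A mA _.
  apply/esym; apply: product_measure_unique => //.
transitivity (\int[distribution Pr XY]_z F z)%E.
  by rewrite /distribution ge0_integral_pushforward// preimage_setT.
rewrite prodE fubini_tonelli1// /distribution ge0_integral_pushforward//.
- rewrite preimage_setT; apply: eq_integral => x _ /=.
  rewrite /fubini_F ge0_integral_pushforward ?preimage_setT//.
  exact: measurableT_comp.
- exact: measurable_fun_fubini_tonelli_F.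
- by move=> x _; exact: integral_ge0.
Qed.

End Decoupling.

Section MatrixMeasurability.
Set Implicit Arguments.
Unset Strict Implicit.
Context {d : measure_display} {T : measurableType d} {R : realType}.

Definition mx_measurable a b (f : T -> 'M[R]_(a, b)) :=
  forall i j, measurable_fun setT (fun w => f w i j).

(** The formula [x^-1 = x exp(- ln (x^2))] also holds at 0, where the inverse is 0 by convention. *)
Lemma measurable_funV (f : T -> R) :
  measurable_fun setT f -> measurable_fun setT (fun w => (f w)^-1).
Proof.
move=> mf.
rewrite (_ : (fun w => (f w)^-1) = fun w => f w * expR (- ln (f w ^+ 2))).
  apply: measurable_funM => //; apply: measurableT_comp => //.
  apply: measurable_funN; apply: measurableT_comp => //.
  exact: measurable_funX.
apply/funext => w; have [->|fw0] := eqVneq (f w) 0; first by rewrite invr0 mul0r.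
rewrite expRN lnK ?posrE; last by rewrite exprn_even_gt0.
by rewrite expr2 invfM mulrA mulfV// mul1r.
Qed.

Lemma mx_measurable_cst a b (A : 'M[R]_(a, b)) : mx_measurable (fun=> A).
Proof. by move=> i j; exact: measurable_cst. Qed.

Lemma mx_measurableD a b (f g : T -> 'M[R]_(a, b)) :
  mx_measurable f -> mx_measurable g -> mx_measurable (fun w => f w + g w).
Proof.
move=> mf mg i j; under eq_fun do rewrite mxE.
exact: measurable_funD.
Qed.

Lemma mx_measurableZ a b (k : R) (f : T -> 'M[R]_(a, b)) :
  mx_measurable f -> mx_measurable (fun w => k *: f w).
Proof.
move=> mf i j; under eq_fun do rewrite mxE.
exact: measurable_funM.
Qed.

Lemma mx_measurable_tr a b (f : T -> 'M[R]_(a, b)) :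
  mx_measurable f -> mx_measurable (fun w => (f w)^T).
Proof. by move=> mf i j; under eq_fun do rewrite mxE; exact: mf. Qed.

Lemma mx_measurableM a b c (f : T -> 'M[R]_(a, b)) (g : T -> 'M[R]_(b, c)) :
  mx_measurable f -> mx_measurable g -> mx_measurable (fun w => f w *m g w).
Proof.
move=> mf mg i j; under eq_fun do rewrite mxE.
by apply: measurable_sum => k; exact: measurable_funM.
Qed.

Lemma mx_measurable_sum a b (I : Type) (s : seq I) (p : pred I)
    (f : I -> T -> 'M[R]_(a, b)) :
  (forall i, mx_measurable (f i)) ->
  mx_measurable (fun w => \sum_(i <- s | p i) f i w).
Proof.
move=> mf; elim: s => [|x s IH].
  by under eq_fun do rewrite big_nil; exact: mx_measurable_cst.
under eq_fun do rewrite big_cons.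
by case: (p x) => //; exact: mx_measurableD.
Qed.

Lemma mx_measurableX a (f : T -> 'M[R]_a) k :
  mx_measurable f -> mx_measurable (fun w => f w ^+ k).
Proof.
move=> mf; elim: k => [|k IH].
  by under eq_fun do rewrite expr0; exact: mx_measurable_cst.
by under eq_fun do rewrite exprS; exact: mx_measurableM.
Qed.

Lemma measurable_mxtrace a (f : T -> 'M[R]_a) :
  mx_measurable f -> measurable_fun setT (fun w => \tr (f w)).
Proof. by move=> mf; apply: measurable_sum. Qed.

Lemma measurable_dot a (f g : T -> 'cV[R]_a) :
  mx_measurable f -> mx_measurable g ->
  measurable_fun setT (fun w => dot (f w) (g w)).
Proof.
move=> mf mg; under eq_fun do rewrite dotE.
by apply: measurable_sum => k; exact: measurable_funM.
Qed.

Lemma measurable_det a (f : T -> 'M[R]_a) :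
  mx_measurable f -> measurable_fun setT (fun w => \det (f w)).
Proof.
move=> mf; apply: measurable_sum => s; apply: measurable_funM => //.
by apply: measurable_prod.
Qed.

(** Invertibility everywhere lets [invmx] unfold to the adjugate over the determinant, whose entries
    are polynomials in those of [f] divided by [\det]. *)
Lemma mx_measurable_inv a (f : T -> 'M[R]_a) : (forall w, f w \in unitmx) ->
  mx_measurable f -> mx_measurable (fun w => invmx (f w)).
Proof.
move=> uf mf i j; under eq_fun => w do rewrite /invmx uf !mxE /cofactor.
apply: measurable_funM; first exact/measurable_funV/measurable_det.
apply: measurable_funM => //; apply: measurable_det => k l.
by under eq_fun do rewrite !mxE; exact: mf.
Qed.

Lemma random_vec_mx_measurable m (X : T -> 'cV[R]_m) :
  random_vec X -> mx_measurable X.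
Proof.
move=> rX i j; apply: (measurability _ (RGenOpens.measurableE R)).
move=> _ [_ [a [b ->] <-]]; rewrite setTI.
have bB : borel_vec ((fun x : 'cV[R]_m => x i j) @^-1` `]a, b[).
  apply: sub_sigma_algebra => /=.
  apply: open_comp; last exact: interval_open.
  by move=> x _; exact: coord_continuous.
exact: (rX _ bB).
Qed.

End MatrixMeasurability.

Lemma mx_measurable_comp d1 d2 (T1 : measurableType d1) (T2 : measurableType d2)
    (R : realType) a b (f : T2 -> 'M[R]_(a, b)) (g : T1 -> T2) :
  measurable_fun setT g -> mx_measurable f -> mx_measurable (fun w => f (g w)).
Proof. by move=> mg mf i j; apply: (measurableT_comp (mf i j)). Qed.

Section Independence.
Set Implicit Arguments.
Unset Strict Implicit.
Context {d : measure_display} {T : measurableType d} {R : realType}.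
Variable Pr : probability T R.
Context {m n : nat}.
Variable h : 'I_n -> T -> 'cV[R]_m.
Hypothesis rh : forall j, random_vec (h j).
Hypothesis ind : mutually_independent Pr h.

Lemma borel_vecT : @borel_vec R m setT.
Proof. exact: (@measurableT _ (g_sigma_algebraType _)). Qed.

Lemma borel_vecI (A B : set 'cV[R]_m) :
  borel_vec A -> borel_vec B -> borel_vec (A `&` B).
Proof. exact: (@measurableI _ (g_sigma_algebraType _)). Qed.

(* A pi-system generating the sigma-algebra of the family [(h j)_(j in J)]. *)
Definition cylinders (J : {set 'I_n}) : set (set T) :=
  [set [set w | forall j, j \in J -> B j (h j w)] |
    B in [set B : 'I_n -> set 'cV[R]_m | forall j, borel_vec (B j)]].

Lemma cylinders_measurable J : cylinders J `<=` measurable.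
Proof.
move=> _ [B mB <-].
rewrite (_ : [set w | _] = \bigcap_(j in [set j | j \in J]) (h j @^-1` B j)).
  by apply: fin_bigcap_measurable => // j _; apply: rh; exact: mB.
by apply/seteqP; split=> w H j; exact: H.
Qed.

Lemma cylinders_setI_closed J : setI_closed (cylinders J).
Proof.
move=> _ _ [A mA <-] [B mB <-]; exists (fun j => A j `&` B j).
  by move=> j; exact: borel_vecI.
apply/seteqP; split=> w; first by move=> H; split=> j /H[].
by move=> [HA HB] j jJ; split; [exact: HA|exact: HB].
Qed.

Lemma cylindersT J : cylinders J setT.
Proof.
exists (fun=> setT); first by move=> j; exact: borel_vecT.
by apply/seteqP; split.
Qed.

(** Measurability for the coarser sigma-algebra of the family, which is what decoupling past sensors
    from a new one requires. *)
Lemma cylinder_random_vec (J : {set 'I_n}) j : j \in J ->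
  random_vec (h j : g_sigma_algebraType (cylinders J) -> 'cV[R]_m).
Proof.
move=> jJ B mB; apply: sub_sigma_algebra.
exists (fun i => if i == j then B else setT).
  by move=> i; case: ifP => // _; exact: borel_vecT.
apply/seteqP; split=> w; first by move/(_ j jJ); rewrite eqxx.
by move=> /= Bw i iJ; case: eqP => [->|].
Qed.

Lemma cylinders_independent (J : {set 'I_n}) k (A B : set T) : k \notin J ->
  cylinders J A -> cylinders [set k]%SET B ->
  Pr (A `&` B) = (Pr A * Pr B)%E.
Proof.
move=> kJ [A' mA <-] [B' mB <-].
(* Since [k] is outside [J], the two cylinders intersect in a single cylinder over [k |: J], to
   which mutual independence applies. *)
pose C j := if j == k then B' k else A' j.
have CA j : j \in J -> C j = A' j.
  by rewrite /C => jJ; case: eqP => // jk; move: kJ; rewrite -jk jJ.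
have -> : [set w | forall j, j \in J -> A' j (h j w)] `&`
    [set w | forall j, j \in [set k]%SET -> B' j (h j w)] =
    [set w | forall j, j \in (k |: J)%SET -> C j (h j w)].
  apply/seteqP; split=> w /=.
    move=> [HA HB] j; rewrite in_setU1 => /predU1P[->|jJ].
      by rewrite /C eqxx; apply: HB; rewrite inE.
    by rewrite CA//; exact: HA.
  move=> H; split=> j; last first.
    by rewrite inE => /eqP->; have := H k; rewrite /C eqxx setU11; exact.
  by move=> jJ; have := H j; rewrite in_setU1 jJ orbT CA//; exact.
rewrite !ind//; last first.
  by move=> j; rewrite /C; case: ifP.
rewrite big_setU1//= big_set1 muleC /C eqxx; congr (_ * _)%E.
by apply: eq_bigr => j jJ; rewrite -/(C j) CA.
Qed.

(** Decoupling with both random elements equal to the identity of [T], seen through two coarser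
    sigma-algebras: that of the family [J] and that of sensor [k]. *)
Lemma decoupling_family (J : {set 'I_n}) k
    (F : g_sigma_algebraType (cylinders J) *
         g_sigma_algebraType (cylinders [set k]%SET) -> \bar R) : k \notin J ->
  measurable_fun setT F -> (forall z, 0 <= F z)%E ->
  (\int[Pr]_w F (w, w) = \int[Pr]_x \int[Pr]_y F (x, y))%E.
Proof.
move=> kJ mF F0.
have sub K (A : set T) : <<s cylinders K >> A -> measurable A.
  apply: smallest_sub; first exact: sigma_algebra_measurable.
  exact: cylinders_measurable.
have mid K : measurable_fun setT (id : T -> g_sigma_algebraType (cylinders K)).
  by move=> _ A sA; rewrite setTI; exact: (sub K).
apply: (@decoupling _ _ _ Pr _ _ _ _ (id : T -> g_sigma_algebraType _)
  (id : T -> g_sigma_algebraType _)) => // A B sA sB.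
(* Independence is extended from cylinders to sigma-algebras one argument at a time: first in [A],
   then in [B] for a fixed cylinder. *)
rewrite !preimage_id; apply: (@indep_sigma _ _ _ _ (cylinders J)) => //.
- exact: (sub [set k]%SET).
- exact: cylinders_measurable.
- exact: cylinders_setI_closed.
- exact: cylindersT.
move=> {sA} {}A GA; rewrite setIC muleC.
apply: (@indep_sigma _ _ _ _ (cylinders [set k]%SET)) => //.
- exact: cylinders_measurable GA.
- exact: cylinders_measurable.
- exact: cylinders_setI_closed.
- exact: cylindersT.
by move=> {sB} {}B GB; rewrite setIC muleC; exact: cylinders_independent GA GB.
Qed.

End Independence.

(** * Second moments of an almost surely bounded random vector *)

Section SecondMoment.
Set Implicit Arguments.
Unset Strict Implicit.
Context {d : measure_display} {T : measurableType d} {R : realType}.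
Variable Pr : probability T R.
Context {m : nat}.
Variables (X : T -> 'cV[R]_m) (v C : R).
Hypotheses (rX : random_vec X) (mean0 : zero_mean Pr X).
Hypothesis covX : has_covariance Pr X v%:M.
Hypothesis bX : {ae Pr, forall w, sqnorm2 (X w) <= C}.

Lemma integrable_coord_mul i j :
  Pr.-integrable setT (fun w => (X w i 0 * X w j 0)%:E).
Proof.
have mX := random_vec_mx_measurable rX.
have mXX : measurable_fun setT (fun w => X w i 0 * X w j 0).
  exact: measurable_funM.
apply/integrableP; split; first exact/measurable_EFinP.
(* The product of two coordinates is dominated by the squared norm; the absolute value makes the
   constant bound nonnegative whatever the sign of [C]. *)
apply: (@le_lt_trans _ _ (\int[Pr]_w (cst (`|C|)%:E w))%E); last first.
  rewrite integral_cst// ltey_eq fin_numM//.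
  exact: fin_num_measure.
apply: ae_ge0_le_integral => //.
- by apply: measurableT_comp => //; exact/measurable_EFinP.
- by move=> w _; rewrite lee_fin.
move: bX; apply: filterS => w bw _; rewrite lee_fin.
apply: le_trans (ler_norm C); apply: le_trans bw.
rewrite normrM -[_ * _]/(`|X w i 0| * `|X w j 0|).
have sq k : `|X w k 0| ^+ 2 <= sqnorm2 (X w).
  rewrite real_normK ?num_real// /sqnorm2 (bigD1 k)//= lerDl.
  by rewrite sumr_ge0// => l _; exact: sqr_ge0.
have := sq i; have := sq j; have := sqr_ge0 (`|X w i 0| - `|X w j 0|); nra.
Qed.

Lemma integral_coord_mul i j :
  (\int[Pr]_w (X w i 0 * X w j 0)%:E = (v *+ (i == j))%:E)%E.
Proof.
have := covX i j; rewrite unlock !mean0 mxE => <-.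
rewrite unlock; apply: eq_integral => w _ /=.
by rewrite -[RHS]/((X w i 0 - 0) * (X w j 0 - 0))%:E !subr0.
Qed.

Lemma integral_quadratic_form (Q : 'M[R]_m) :
  (\int[Pr]_w (dot (X w) (Q *m X w))%:E = (v * \tr Q)%:E)%E.
Proof.
transitivity (\int[Pr]_w \sum_i \sum_j
    ((Q i j)%:E * (X w i 0 * X w j 0)%:E))%E.
  apply: eq_integral => w _; rewrite dotE -sumEFin; apply: eq_bigr => i _.
  rewrite mxE mulr_sumr -sumEFin; apply: eq_bigr => j _.
  by rewrite -EFinM mulrCA.
have iQ i j : Pr.-integrable setT
    (fun w => (Q i j)%:E * (X w i 0 * X w j 0)%:E)%E.
  by apply: integrableZl => //; exact: integrable_coord_mul.
rewrite integral_sum//; last by move=> i; apply: integrable_sum.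
rewrite /mxtrace mulr_sumr -sumEFin; apply: eq_bigr => i _.
rewrite integral_sum// (bigD1 i)//= big1 ?adde0 => [|j ji].
  rewrite integralZl//; last exact: integrable_coord_mul.
  by rewrite integral_coord_mul eqxx -EFinM mulrC.
rewrite integralZl//; last exact: integrable_coord_mul.
by rewrite integral_coord_mul eq_sym (negbTE ji) mule0.
Qed.

End SecondMoment.

(** * The Chernoff bound *)

Section Chernoff.
Set Implicit Arguments.
Unset Strict Implicit.
Context {d : measure_display} {T : measurableType d} {R : realType}.
Variable Pr : probability T R.
Context {m n : nat}.
Variable h : 'I_n -> T -> 'cV[R]_m.
Hypothesis rh : forall j, random_vec (h j).
Hypothesis ind : mutually_independent Pr h.
Variables (v C : R).
Hypothesis v0 : 0 <= v.
Hypothesis mean0 : forall j, zero_mean Pr (h j).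
Hypothesis covh : forall j, has_covariance Pr (h j) v%:M.
Hypothesis bh : forall j, {ae Pr, forall w, sqnorm2 (h j w) <= C}.

(** The matrix [D_k], with [c ^+ 2] in the role of [theta / N]. The scaling sits inside the vectors
    so that each update is literally of the form [g g^T]. *)
Definition shifted_gram c k w : 'M[R]_m :=
  1%:M + \sum_(j < n | (j < k)%N) (c *: h j w) *m (c *: h j w)^T.

Lemma shifted_gram_form c k w x : dot x (shifted_gram c k w *m x) =
  dot x x + c ^+ 2 * \sum_(j < n | (j < k)%N) dot (h j w) x ^+ 2.
Proof.
rewrite mulmxDl mul1mx dotDr; congr (_ + _).
rewrite mulmx_suml dot_sumr mulr_sumr; apply: eq_bigr => j _.
by rewrite mul_col_tr !dotZr dotZl (dotC x); ring.
Qed.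

Lemma shifted_gram_id_le c k w : id_le (shifted_gram c k w).
Proof.
split=> [|x].
  rewrite linearD /= trmx1 linear_sum /=; congr (_ + _).
  by apply: eq_bigr => j _; rewrite trmx_mul trmxK.
rewrite shifted_gram_form lerDl mulr_ge0 ?sqr_ge0// sumr_ge0// => j _.
exact: sqr_ge0.
Qed.

Lemma shifted_gramS c (k : 'I_n) w : shifted_gram c k.+1 w =
  shifted_gram c k w + (c *: h k w) *m (c *: h k w)^T.
Proof.
rewrite /shifted_gram -addrA; congr (_ + _).
rewrite (bigD1 k)//= addrC; congr (_ + _); apply: eq_bigl => j.
by rewrite ltnS ltn_neqAle andbC.
Qed.

Lemma trace_expr_ge0 c k N w : 0 <= \tr (shifted_gram c k w ^+ N).
Proof.
apply: sumr_ge0 => i _.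
have := (expr_psd N (shifted_gram_id_le c k w)).2 (delta_mx i 0).
rewrite dotE (bigD1 i)//= big1 => [|j ji]; last by rewrite mxE (negbTE ji) mul0r.
rewrite mxE !eqxx mul1r addr0 mxE (bigD1 i)//= big1 => [|j ji].
  by rewrite mxE !eqxx mulr1 addr0.
by rewrite !mxE (negbTE ji) mulr0.
Qed.

(** The map [X] allows both [T] itself and a product of coarser sigma-algebras as the source; only
    the first [k] vectors have to be measurable there. *)
Lemma mx_measurable_shifted_gram {d'} {T' : measurableType d'}
    (X : T' -> T) c k :
  (forall j : 'I_n, (j < k)%N -> mx_measurable (fun w => h j (X w))) ->
  mx_measurable (fun w => shifted_gram c k (X w)).
Proof.
move=> mX; apply: mx_measurableD; first exact: mx_measurable_cst.
under eq_fun do rewrite big_mkcond.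
apply: mx_measurable_sum => j.
have [jk|jk] := boolP (j < k)%N; last exact: mx_measurable_cst.
apply: mx_measurableM; last apply: mx_measurable_tr; apply: mx_measurableZ;
  exact: mX.
Qed.

Lemma measurable_trace_expr c k N :
  measurable_fun setT (fun w => \tr (shifted_gram c k w ^+ N)).
Proof.
apply/measurable_mxtrace/mx_measurableX/(@mx_measurable_shifted_gram _ _ id).
by move=> j _; exact: random_vec_mx_measurable.
Qed.

(** [shifted_gram c k] involves only sensors before [k], so [h k] can be integrated out first; its
    covariance [v I] turns the quadratic form into [v] times the trace. *)
Lemma integral_form_shifted_gram c N (k : 'I_n) :
  (\int[Pr]_w (dot (h k w) (shifted_gram c k w ^+ N *m h k w))%:E =
   v%:E * \int[Pr]_w (\tr (shifted_gram c k w ^+ N))%:E)%E.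
Proof.
pose J := [set j : 'I_n | (j < k)%N]%SET.
pose T1 := g_sigma_algebraType (cylinders h J).
pose T2 := g_sigma_algebraType (cylinders h [set k]%SET).
pose F (z : T1 * T2) :=
  (dot (h k z.2) (shifted_gram c k z.1 ^+ N *m h k z.2))%:E.
have kJ : k \notin J by rewrite inE ltnn.
have mF : measurable_fun setT F.
  have mk : mx_measurable (fun z : T1 * T2 => h k z.2).
    apply: (@mx_measurable_comp _ _ _ T2 _ _ _ (h k) snd) => //.
    by apply: random_vec_mx_measurable; apply: cylinder_random_vec; rewrite inE.
  apply/measurable_EFinP/measurable_dot => //; apply: mx_measurableM => //.
  apply: mx_measurableX; apply: mx_measurable_shifted_gram => j jk.
  apply: (@mx_measurable_comp _ _ _ T1 _ _ _ (h j) fst) => //.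
  by apply: random_vec_mx_measurable; apply: cylinder_random_vec; rewrite inE.
have F0 z : (0 <= F z)%E.
  by rewrite lee_fin; exact: (expr_psd _ (shifted_gram_id_le _ _ _)).2.
rewrite (decoupling_family rh ind kJ mF F0).
rewrite -ge0_integralZl//.
- apply: eq_integral => x _; rewrite /F/=.
  by rewrite (integral_quadratic_form (rh k) (mean0 k) (covh k) (@bh k)).
- exact/measurable_EFinP/measurable_trace_expr.
- by move=> x _; rewrite lee_fin trace_expr_ge0.
Qed.

(** Starting from [tr I = m], each sensor multiplies the expected trace by at most [1 + q v], by the
    rank-one trace bound and the preceding integration. *)
Lemma integral_trace_expr_le c N (k : nat) : (k <= n)%N -> 0 <= C ->
  (\int[Pr]_w (\tr (shifted_gram c k w ^+ N))%:E <=
  (m%:R * (1 + N%:R * (1 + c ^+ 2 * C) ^+ N * c ^+ 2 * v) ^+ k)%:E)%E.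
Proof.
move=> kn C0; set q := N%:R * (1 + c ^+ 2 * C) ^+ N * c ^+ 2.
have q0 : 0 <= q.
  rewrite mulr_ge0 ?sqr_ge0// mulr_ge0// exprn_ge0// addr_ge0//.
  by rewrite mulr_ge0 ?sqr_ge0.
elim: k kn => [|k IH] kn.
  rewrite (eq_integral (cst (m%:R)%:E)) => [|w _].
    rewrite integral_cst//.
    by rewrite expr0 mulr1 -[leRHS]mule1 -(probability_setT Pr).
  rewrite /shifted_gram big_pred0// addr0; congr (_%:E).
  by rewrite (_ : 1%:M ^+ N = 1%:M) ?mxtrace1//; exact: expr1n.
have := IH (ltnW kn); set K := Ordinal kn => {}IH.
have mtr l : measurable_fun setT (fun w => (\tr (shifted_gram c l w ^+ N))%:E).
  exact/measurable_EFinP/measurable_trace_expr.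
have mdot : measurable_fun setT
    (fun w => (dot (h K w) (shifted_gram c K w ^+ N *m h K w))%:E).
  apply/measurable_EFinP/measurable_dot.
    exact: random_vec_mx_measurable.
  apply: mx_measurableM; last exact: random_vec_mx_measurable.
  apply/mx_measurableX/(@mx_measurable_shifted_gram _ _ id) => j _.
  exact: random_vec_mx_measurable.
have dot0 w : (0 <= (dot (h K w) (shifted_gram c K w ^+ N *m h K w))%:E)%E.
  by rewrite lee_fin; exact: (expr_psd _ (shifted_gram_id_le _ _ _)).2.
have tr0 l w : (0 <= (\tr (shifted_gram c l w ^+ N))%:E)%E.
  by rewrite lee_fin trace_expr_ge0.
have mqdot : measurable_fun setT (fun w =>
    q%:E * (dot (h K w) (shifted_gram c K w ^+ N *m h K w))%:E)%E.
  exact: measurable_funeM.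
have qdot0 w : (0 <= q%:E *
    (dot (h K w) (shifted_gram c K w ^+ N *m h K w))%:E)%E.
  by rewrite mule_ge0.
apply: (@le_trans _ _ (\int[Pr]_w ((\tr (shifted_gram c K w ^+ N))%:E +
    q%:E * (dot (h K w) (shifted_gram c K w ^+ N *m h K w))%:E))%E).
  apply: ae_ge0_le_integral => //.
  - by move=> w _; rewrite adde_ge0.
  - exact: emeasurable_funD.
  (* Here the almost sure bound by [C] replaces the random factor [(1 + |g|^2)^N] by a constant,
     leaving only the form in [h K] to integrate. *)
  move: (@bh K); apply: filterS => w bw _.
  rewrite (_ : k.+1 = K.+1)// shifted_gramS -EFinM -EFinD lee_fin.
  apply: le_trans (trace_rank1_expr_le _ _ (shifted_gram_id_le _ _ _)) _.
  rewrite lerD2l -scalemxAr !(dotZl, dotZr) dot_sqnorm2 !mulrA -expr2.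
  have hQh := dot0 w; rewrite lee_fin in hQh.
  rewrite ler_wpM2r// -[leLHS]mulrA -expr2 ler_wpM2r ?sqr_ge0// ler_wpM2l//.
  have s0 : 0 <= c ^+ 2 * sqnorm2 (h K w).
    by rewrite mulr_ge0 ?sqr_ge0// -dot_sqnorm2 dot_ge0.
  rewrite lerXn2r ?nnegrE ?addr_ge0 ?lerD2l ?ler_wpM2l ?sqr_ge0//.
  by rewrite mulr_ge0 ?sqr_ge0.
rewrite ge0_integralD// ge0_integralZl//.
rewrite integral_form_shifted_gram muleA -EFinM -[X in (X + _ <= _)%E]mul1e.
rewrite -ge0_muleDl ?lee_fin//; last by rewrite mulr_ge0.
apply: le_trans (lee_wpmul2l _ IH) _.
  by rewrite -EFinD lee_fin addr_ge0// mulr_ge0.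
by rewrite -EFinD -EFinM lee_fin exprS mulrCA.
Qed.

(** Markov's inequality for the trace. The exponent is even to match the trace bound on Rayleigh
    quotients. *)
Lemma gram_tail c N t : 0 <= C -> 0 <= t ->
  ((1 - m%:R * (1 + N.*2%:R * (1 + c ^+ 2 * C) ^+ N.*2 * c ^+ 2 * v) ^+ n /
     (1 + c ^+ 2 * t) ^+ N.*2)%:E <=
   Pr [set w |
     (\tr (shifted_gram c n w ^+ N.*2) < (1 + c ^+ 2 * t) ^+ N.*2)%R])%E.
Proof.
move=> C0 t0; set L := m%:R * _ ^+ n; set a := (1 + c ^+ 2 * t) ^+ N.*2.
have a0 : 0 < a by rewrite exprn_gt0// ltr_pwDl// mulr_ge0// sqr_ge0.
have mtr := measurable_trace_expr c n N.*2.
pose X : {RV Pr >-> R} := HB.pack (fun w => \tr (shifted_gram c n w ^+ N.*2))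
  (isMeasurableFun.Build _ _ _ _ _ mtr).
have mbad : measurable [set w | a <= \tr (shifted_gram c n w ^+ N.*2)].
  rewrite -[X in measurable X]setTI.
  exact: (measurable_fun_ler (measurable_cst _) mtr).
have bad :
    (Pr [set w | (a <= \tr (shifted_gram c n w ^+ N.*2))%R] <= (L / a)%:E)%E.
  rewrite EFinM muleC lee_pdivlMl//.
  apply: (@le_trans _ _ 'E_Pr[X]%E); last first.
    by rewrite unlock; exact: integral_trace_expr_le.
  have := @markov _ _ _ Pr X id a a0 (@measurable_id _ _ _) (fun _ => id)
    (fun _ _ _ _ => id).
  have XE w : `|X w| = \tr (shifted_gram c n w ^+ N.*2).
    by rewrite ger0_norm// trace_expr_ge0.
  have -> : [set x | (a%:E <= `|(X x)%:E|)%E] =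
      [set w | a <= \tr (shifted_gram c n w ^+ N.*2)].
    by apply/seteqP; split=> w /=; rewrite lee_fin XE.
  by congr (_ <= 'E_Pr[_])%E; apply/funext => w; exact: XE.
have -> : [set w | \tr (shifted_gram c n w ^+ N.*2) < a] =
    ~` [set w | a <= \tr (shifted_gram c n w ^+ N.*2)].
  by apply/seteqP; split=> w /=; rewrite ltNge => /negP.
by rewrite probability_setC// EFinB leeB.
Qed.

(** The trace bounds the [N.*2]-th power of every Rayleigh quotient of the shifted Gram matrix;
    after taking roots, the identity and the factor [c ^+ 2] cancel. *)
Lemma trace_lt_gram_le c N t w x : 0 < c -> 0 <= t -> (0 < N)%N ->
  \tr (shifted_gram c n w ^+ N.*2) < (1 + c ^+ 2 * t) ^+ N.*2 ->
  dot x ((\sum_j h j w *m (h j w)^T) *m x) <= t * dot x x.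
Proof.
move=> c0 t0 N0 trlt; have [->|x0] := eqVneq x 0.
  by rewrite !dot0l mulr0.
have ct0 : 0 <= 1 + c ^+ 2 * t by rewrite addr_ge0// mulr_ge0// sqr_ge0.
have : dot x (shifted_gram c n w *m x) <= (1 + c ^+ 2 * t) * dot x x.
  have B1 := shifted_gram_id_le c n w.
  rewrite -(@ler_pXn2r _ N.*2) ?double_gt0// ?nnegrE.
  - apply: le_trans (dot_le_trace_expr _ B1 x0) _.
    by rewrite exprMn ler_wpM2r ?exprn_ge0 ?dot_ge0// ltW.
  - exact: le_trans (dot_ge0 _) (B1.2 x).
  - by rewrite mulr_ge0 ?dot_ge0.
rewrite shifted_gram_form mulrDl mul1r lerD2l -mulrA ler_pM2l ?exprn_gt0//.
apply: le_trans; rewrite mulmx_suml dot_sumr.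
rewrite [leRHS](eq_bigl xpredT) => [|j]; last by rewrite ltn_ord.
by apply: ler_sum => j _; rewrite mul_col_tr dotZr (dotC x) expr2.
Qed.

End Chernoff.

(** * The curvature event *)

Section MaxCurvature.
Set Implicit Arguments.
Unset Strict Implicit.
Context {R : realType} {n : nat}.

Lemma ereal_ratio_le (a b D : R) : 0 <= a -> (a = 0 -> b = 0) -> 0 <= D ->
  (b%:E / a%:E <= D%:E)%E = (b <= D * a).
Proof.
(* When [a = 0] the quotient is [0 * +oo = 0], and both sides hold. *)
move=> a0 ab D0; have [az|an] := eqVneq a 0.
  by rewrite az ab// inve0 mul0e mulr0 lee_fin D0 lexx.
by rewrite inver (negbTE an) -EFinM lee_fin ler_pdivrMr// lt_neqAle eq_sym an.
Qed.

(** Replaces the extended-real maximum by finitely many real inequalities without division, a form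
    suited both to measurability and to the ratio bound. *)
Lemma max_curvature_leP (f : {set 'I_n} -> R) (D : R) : 0 <= D ->
  (forall i (S : {set 'I_n}), i \notin S -> 0 <= marginal f i S) ->
  (forall i (A B : {set 'I_n}), i \notin A -> i \notin B ->
    marginal f i A = 0 -> marginal f i B = 0) ->
  (max_curvature f <= D%:E)%E <->
  (forall (A B : {set 'I_n}) i, A \proper B -> i \notin B ->
    marginal f i B <= D * marginal f i A).
Proof.
move=> D0 f0 fz.
have ratio (A B : {set 'I_n}) i : A \proper B -> i \notin B ->
    ((marginal f i B)%:E / (marginal f i A)%:E <= D%:E)%E =
    (marginal f i B <= D * marginal f i A).
  move=> AB iB; have iA : i \notin A.
    by apply: contra iB; exact: (fintype.subsetP (proper_sub AB)).
  by rewrite ereal_ratio_le//; [exact: f0|exact: fz].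
split=> [fD A B i AB iB|H].
  (* The level of the triple lies in the range of the maximum: [A] is proper in [B], and [B] misses
     [i]. *)
  have lB : (0 < #|B :\: A| < n)%N.
    move: (AB); rewrite properE => /andP[_ BA].
    rewrite card_gt0 finset.setD_eq0 BA/=.
    apply: leq_ltn_trans (subset_leq_card (finset.subsetDl _ _)) _.
    rewrite -[X in (_ < X)%N]card_ord -cardsT; apply: proper_card.
    by rewrite properT; apply: contraNneq iB => ->; rewrite inE.
  rewrite -ratio//; apply: le_trans fD.
  apply: (@Order.TotalTheory.bigmax_sup_seq _ _ _ _ _ #|B :\: A|) => //.
    by rewrite mem_index_iota.
  apply: (@Order.TotalTheory.bigmax_sup _ _ _ _ (A, B, i)) => //.
  rewrite inE AB iB eqxx properT /= ?andbT.
  by apply: contraNneq iB => ->; rewrite inE.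
apply: Order.POrderTheory.bigmax_le => [|l _]; first exact: leNye.
apply: Order.POrderTheory.bigmax_le => [|[[A B] i]]; first exact: leNye.
by rewrite inE => /and4P[AB _ iB _]; rewrite ratio//; exact: H.
Qed.

End MaxCurvature.

Section EventMeasurable.
Set Implicit Arguments.
Unset Strict Implicit.
Context {d : measure_display} {T : measurableType d} {R : realType} {m n : nat}.
Variables (P : 'M[R]_m) (s2 : R) (h : 'I_n -> T -> 'cV[R]_m).
Variable (sigma2 : 'I_n -> R).
Hypotheses (m0 : (0 < m)%N) (hP : posdefmx P) (s20 : 0 < s2).
Hypothesis hsigma2 : forall j, sigma2 j = s2.
Hypothesis rh : forall j, random_vec (h j).

Lemma measurable_marginal i S : measurable_fun setT
  (fun w => marginal (mse_gain P (fun j => h j w) sigma2) i S).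
Proof.
have mgain A : measurable_fun setT
    (fun w => mse_gain P (fun j => h j w) sigma2 A).
  apply: measurable_mxtrace; apply: mx_measurableD.
    exact: mx_measurable_cst.
  under eq_fun do rewrite -scaleN1r.
  apply: mx_measurableZ; apply: mx_measurable_inv.
    by move=> w; exact: (Fmx_unit m0 hP s20).
  apply: mx_measurableD; first exact: mx_measurable_cst.
  apply: mx_measurable_sum => j; apply: mx_measurableZ.
  by apply: mx_measurableM; last apply: mx_measurable_tr;
    exact: random_vec_mx_measurable.
exact: measurable_funB.
Qed.

Lemma max_curvature_mse_gainP w D : 0 <= D ->
  (max_curvature (mse_gain P (fun j => h j w) sigma2) <= D%:E)%E <->
  (forall (A B : {set 'I_n}) i, A \proper B -> i \notin B ->
    marginal (mse_gain P (fun j => h j w) sigma2) i B <=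
    D * marginal (mse_gain P (fun j => h j w) sigma2) i A).
Proof.
move=> D0; apply: max_curvature_leP => // [i S iS|i A B iA iB /eqP].
  exact: (marginal_mse_gain_ge0 m0 hP s20).
rewrite (marginal_mse_gain_eq0 m0 hP s20)// => hi0; apply/eqP.
by rewrite (marginal_mse_gain_eq0 m0 hP s20).
Qed.

Lemma measurable_max_curvature_le D : 0 <= D ->
  measurable [set w |
    (max_curvature (mse_gain P (fun j => h j w) sigma2) <= D%:E)%E].
Proof.
move=> D0.
pose K := [set x : {set 'I_n} * {set 'I_n} * 'I_n |
  x.1.1 \proper x.1.2 /\ x.2 \notin x.1.2].
rewrite (_ : [set w | _] = \bigcap_(x in K) [set w |
    marginal (mse_gain P (fun j => h j w) sigma2) x.2 x.1.2 <=
    D * marginal (mse_gain P (fun j => h j w) sigma2) x.2 x.1.1]).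
  apply: fin_bigcap_measurable => [|x _]; first exact: finite_finset.
  rewrite -[X in measurable X]setTI.
  apply: measurable_fun_ler => //; first exact: measurable_marginal.
  by apply: measurable_funM => //; exact: measurable_marginal.
apply/seteqP; split=> w /=.
  by move/(max_curvature_mse_gainP _ D0) => H [[A B] i] [/= AB iB]; exact: H.
move=> H; apply/(max_curvature_mse_gainP _ D0) => A B i AB iB.
exact: (H (A, B, i)).
Qed.

End EventMeasurable.

(** * Scalar estimates and conclusion *)

Lemma expR_div_le_1D (R : realType) (r x : R) :
  0 <= x -> 1 + x <= r -> expR (x / r) <= 1 + x.
Proof.
move=> x0 xr.
have x1 : 0 < 1 + x by rewrite ltr_pwDl.
apply: (@le_trans _ _ (expR (x / (1 + x)))).
  by rewrite ler_expR ler_wpM2l// lef_pV2// posrE// (lt_le_trans x1).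
rewrite -[leRHS]invrK -[leLHS]invrK -expRN lef_pV2 ?posrE ?expR_gt0 ?invr_gt0//.
(* [1 - x / (1 + x)] equals [(1 + x)^-1]. *)
apply: le_trans (expR_ge1Dx _); rewrite le_eqVlt; apply/orP; left; apply/eqP.
by field; rewrite gt_eqF.
Qed.

(** A finite-[N] form of the exponential Chernoff ratio: [r] pays once for [(1 + theta C / N)^N] in
    the numerator and once for the gap between [(1 + theta t / N)^N] and [exp(theta t)]. *)
Lemma chernoff_ratio_le (R : realType) (r theta C v t : R) (n N : nat) :
  0 < theta -> 0 <= C -> 0 <= v -> 0 <= t -> (0 < N)%N ->
  expR (theta * C) <= r -> 1 + theta / N%:R * t <= r ->
  (1 + N%:R * (1 + theta / N%:R * C) ^+ N * (theta / N%:R) * v) ^+ n /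
    (1 + theta / N%:R * t) ^+ N <=
  expR (n%:R * (theta * r * v) - theta * t / r).
Proof.
move=> th0 C0 v0 t0 N0 Cr tr.
have NR : 0 < N%:R :> R by rewrite ltr0n.
have N_neq0 : N%:R != 0 :> R by rewrite gt_eqF.
have r0 : 0 < r := lt_le_trans (expR_gt0 _) Cr.
have thN : 0 <= theta / N%:R by rewrite divr_ge0// ltW.
set K := 1 + theta / N%:R * C; have K0 : 0 <= K by rewrite addr_ge0// mulr_ge0.
have KN : K ^+ N <= r.
  apply: le_trans Cr.
  have -> : theta * C = N%:R * (theta / N%:R * C) by field.
  by rewrite expRM_natl lerXn2r ?nnegrE ?expR_ge0// expR_ge1Dx.
have -> : N%:R * K ^+ N * (theta / N%:R) * v = theta * K ^+ N * v by field.
have A0 : 0 <= theta * K ^+ N * v by rewrite !mulr_ge0 ?exprn_ge0// ltW.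
have t1 : 0 <= theta / N%:R * t by rewrite mulr_ge0.
rewrite expRD; apply: ler_pM.
- by rewrite exprn_ge0// addr_ge0.
- by rewrite invr_ge0 exprn_ge0// addr_ge0.
- rewrite expRM_natl lerXn2r ?nnegrE ?expR_ge0 ?addr_ge0//.
  apply: le_trans (expR_ge1Dx _); rewrite lerD2l ler_wpM2r//.
  by rewrite ler_wpM2l// ltW.
rewrite expRN lef_pV2 ?posrE ?expR_gt0 ?exprn_gt0 ?ltr_pwDl//.
have -> : theta * t / r = N%:R * (theta / N%:R * t / r).
  by field; rewrite N_neq0 gt_eqF.
rewrite expRM_natl lerXn2r ?nnegrE ?expR_ge0 ?addr_ge0//.
exact: expR_div_le_1D.
Qed.

Theorem corollary1p1 (R : realType) (c1 : R) (hc1 : 1 < c1)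
    (eps : R) (heps : 0 < eps) :
  exists2 c2 : R, 0 < c2 &
  exists m0 : nat,
  forall (m n : nat) (hm : (0 < m)%N) (hm0 : (m0 <= m)%N) (hn : (0 < n)%N)
    (P : 'M[R]_m) (hP : posdefmx P)
    (d : measure_display) (T : measurableType d) (Pr : probability T R)
    (h : 'I_n -> T -> 'cV[R]_m)
    (hiid : iid Pr h)
    (sigmah2 C : R)
    (hmean : forall j, zero_mean Pr (h j))
    (hcov : forall j, has_covariance Pr (h j) (sigmah2%:M))
    (hbound : forall j, {ae Pr, forall w, sqnorm2 (h j w) <= C})
    (hsC : sigmah2 < C)
    (hsigmah2 : sigmah2 = m%:R^-1)
    (hC : `|C - 1| <= eps)
    (sigma2 : 'I_n -> R) (s2 : R) (hs2 : 0 < s2)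
    (hsigma2 : forall j, sigma2 j = s2)
    (q : R) (hq : 0 < q)
    (Delta : R) (hDelta1 : 1 < Delta)
    (hphi : phi P sigma2 sigmah2 q >= lambda_max P / Delta)
    (hDelta : Delta >= kappa P + c1 * (n%:R / m%:R) * SNR P s2),
  let E := [set w | (max_curvature (mse_gain P (fun j => h j w) sigma2)
                       <= (Delta ^+ 3)%:E)%E] in
  measurable E /\
  ((1 - m%:R * expR (- (n%:R / m%:R * c2)))%:E <= Pr E)%E.
Proof.
have c10 : 0 < c1 by lra.
(* [r] is the cube root of [c1], and [theta] is tuned so that [exp(theta (1 + eps)) = r], which
   dominates [exp(theta C)]. *)
pose r := expR (ln c1 / 3%:R); pose theta := ln c1 / 3%:R / (1 + eps).
have lnc1 : 0 < ln c1 / 3%:R by rewrite divr_gt0// ln_gt0.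
have eps1 : 0 < 1 + eps by rewrite addr_gt0.
have th0 : 0 < theta by rewrite divr_gt0.
have r1 : 1 < r by rewrite -expR0 ltr_expR.
have r3 : c1 = r ^+ 3.
  by rewrite -expRM_natl -mulr_natl mulrC divfK ?lnK// pnatr_eq0.
(* With [v = 1/m] and [t = r^3 n/m], the exponent [n theta r v - theta t / r] is
   [- (n/m) theta (r^2 - r)]: two factors [r] are lost and the third leaves a strict gain. *)
exists (theta * (r ^+ 2 - r)).
  by rewrite mulr_gt0// subr_gt0 expr2 ltr_pMr// (lt_trans ltr01).
exists 0%N => m n hm _ _ P hP d T Pr h [rh ind _] sigmah2 C hmean hcov hbound.
move=> hsC hsigmah2 hC sigma2 s2 hs2 hsigma2 _ _ Delta hDelta1 _ hDelta /=.
have D3 : 0 <= Delta ^+ 3 by rewrite exprn_ge0// ltW// (lt_trans ltr01).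
have mE := measurable_max_curvature_le hm hP hs2 hsigma2 rh D3.
split; first exact: mE.
have v0 : 0 < m%:R^-1 :> R by rewrite invr_gt0 ltr0n.
rewrite hsigmah2 in hcov hsC.
have C0 : 0 <= C by rewrite (le_trans (ltW v0))// ltW.
pose t := c1 * (n%:R / m%:R).
have t0 : 0 <= t by rewrite mulr_ge0 ?(ltW c10)// divr_ge0.
(* Large enough that [1 + theta t / N.*2 <= r]; the successor keeps the exponent positive. *)
pose N := (Num.bound (theta * t / (r - 1))).+1.
have N0 : (0 < N.*2)%N by rewrite double_gt0.
have NR : 0 < N.*2%:R :> R by rewrite ltr0n.
pose c := Num.sqrt (theta / N.*2%:R).
have c2E : c ^+ 2 = theta / N.*2%:R by rewrite sqr_sqrtr// divr_ge0// ltW.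
have c0 : 0 < c by rewrite sqrtr_gt0 divr_gt0.
have tail := gram_tail rh ind (ltW v0) hmean hcov hbound c N C0 t0.
(* On the trace event the Gram matrix is at most [t I] with [t = c1 n / m], so the ratio bound is
   [(kappa + t SNR)^3], at most [Delta ^+ 3] by [hDelta]. *)
have good w : \tr (shifted_gram h c n w ^+ N.*2) < (1 + c ^+ 2 * t) ^+ N.*2 ->
    (max_curvature (mse_gain P (fun j => h j w) sigma2) <= (Delta ^+ 3)%:E)%E.
  move=> trlt.
  apply/(@max_curvature_mse_gainP _ _ _ _ _ _ _ h _ hm hP hs2 hsigma2 _ _ D3).
  move=> A B i AB iB.
  have gram_le x := trace_lt_gram_le x c0 t0 (ltn0Sn _) trlt.
  have iA : i \notin A.
    by apply: contra iB; exact: (fintype.subsetP (proper_sub AB)).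
  apply: le_trans (marginal_ratio hm hP hs2 hsigma2 gram_le iA iB) _.
  apply: ler_wpM2r; first exact: (marginal_mse_gain_ge0 hm hP hs2).
  have L0 := lambda_max_gt0 hm hP; have l0 := lambda_min_gt0 hm hP.
  rewrite lerXn2r ?nnegrE ?(ltW (lt_trans ltr01 hDelta1))//.
  have k0 : 0 <= kappa P by rewrite divr_ge0 ?ltW.
  have S0 : 0 <= SNR P s2 by rewrite divr_ge0 ?ltW.
  exact: addr_ge0 k0 (mulr_ge0 t0 S0).
have mgood : measurable
    [set w | \tr (shifted_gram h c n w ^+ N.*2) < (1 + c ^+ 2 * t) ^+ N.*2].
  rewrite -[X in measurable X]setTI.
  exact: (measurable_fun_ltr (measurable_trace_expr rh c n N.*2)
    (measurable_cst _)).
apply: (@le_trans _ _ (Pr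
    [set w | \tr (shifted_gram h c n w ^+ N.*2) < (1 + c ^+ 2 * t) ^+ N.*2])).
  apply: le_trans tail; rewrite lee_fin lerD2l lerN2 -mulrA ler_wpM2l//.
  rewrite !c2E.
  apply: le_trans
    (@chernoff_ratio_le _ r _ _ _ _ _ _ th0 C0 (ltW v0) t0 N0 _ _) _.
  - have -> : r = expR (theta * (1 + eps)) by rewrite divfK// gt_eqF.
    rewrite ler_expR ler_wpM2l//; first exact: ltW.
    by have := ler_norm (C - 1); lra.
  - rewrite addrC -lerBrDr mulrAC ler_pdivrMr// -ler_pdivrMl ?subr_gt0// mulrC.
    have r10 : 0 <= theta * t / (r - 1).
      apply: divr_ge0; first exact: mulr_ge0 (ltW th0) t0.
      by rewrite subr_ge0 ltW.
    apply/ltW/(lt_le_trans (archi_boundP r10)).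
    by rewrite ler_nat -addnn (leq_trans (leqnSn _))// leq_addr.
  rewrite ler_expR /t r3 le_eqVlt; apply/orP; left; apply/eqP.
  by field; rewrite !gt_eqF ?ltr0n// (lt_trans ltr01).
by apply: le_measure; rewrite ?inE.
Qed.
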